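(* Let $T>0$, $f_0,f_T$ smooth, $K_1,K_2\ge1$ integers, and let $A$, $c_1$, $c_2$, $J_1$, $a_0,\dots,a_{K+1}$ and $S_0,\dots,S_K$ be as defined in the context. Then: (i) $S_j\neq\emptyset$ for some $j\in\{0,\dots,K\}$. A function $v\in C[-T,T]$ with $\int_{-T}^T v\,dx=A$ minimizes $J_1$ among all functions in $C[-T,T]$ with integral $A$ if and only if $v\in S_j$ for some $j\in\{0,\dots,K\}$, and the minimal value equals the infimum of $\|w\|_{L^1[-(2K_1+1)T,(2K_2+1)T]}$ over all inputs $w$ of solutions of the TBVP. (ii) A minimum-input solution for the $L^1$ metric exists if and only if there are $j\in\{0,\dots,K\}$ and $v\in S_j$ such that $v\in C^1[-T,T]$, $v(T)=v(-T)+c_1$ and $v'(T)=v'(-T)+c_2$; for any such $v$, the solution induced by $\hat v$ is a minimum-input solution.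
   Context: TBVP: given smooth $f_0,f_T:\mathbb R\to\mathbb R$ and $T>0$, a solution is a function $u\in C^2([0,T]\times\mathbb R)$ with $u_{tt}-u_{xx}=0$, $u(0,x)=f_0(x)$, $u(T,x)=f_T(x)$. Its input is $v(x)=u_t(0,x)$; the set of all inputs is the input space. The solution induced by an input $v$ is $u(t,x)=\frac12(f_0(x+t)+f_0(x-t))+\frac12\int_{x-t}^{x+t}v(s)\,ds$. Metric: fix integers $K_1,K_2\ge 1$, put $K=K_1+K_2+1$; inputs are measured by the norm of $L^1[-(2K_1+1)T,(2K_2+1)T]$. A minimum-input solution (MS) is a solution whose input has minimal norm among all inputs. Constants: $A=2f_T(0)-f_0(T)-f_0(-T)$, $c_1=2f_T'(0)-f_0'(T)-f_0'(-T)$, $c_2=2f_T''(0)-f_0''(T)-f_0''(-T)$. Extension: for $v\in C[-T,T]$, $\hat v:\mathbb R\to\mathbb R$ is the unique function that agrees with $v$ on $[-T,T)$ and satisfies $\hat v(x+T)=\hat v(x-T)+2f_T'(x)-f_0'(x+T)-f_0'(x-T)$ for all $x\in\mathbb R$. Put $J_1(v)=\|\hat v\|_{L^1[-(2K_1+1)T,(2K_2+1)T]}$. Functions $t_i$ on $[-T,T]$, $i=1,\dots,K$: $t_1=0$; for $k=1,\dots,K_2$, $$t_{k+1}(x)=f_0'(x)+2\sum_{n=0}^{k-1}f_0'(x+(2k-2n)T)-2\sum_{n=0}^{k-1}f_T'(x+(2k-2n-1)T)-f_0'(x+2kT);$$ for $k=1,\dots,K_1$, $$t_{k+K_2+1}(x)=f_0'(x)+2\sum_{n=0}^{k-1}f_T'(x+(2n+1-2k)T)-2\sum_{n=0}^{k-1}f_0'(x+2(n+1-k)T)-f_0'(x-2kT).$$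 For $x\in[-T,T]$ let $a_1(x)\ge a_2(x)\ge\dots\ge a_K(x)$ be the values $t_1(x),\dots,t_K(x)$ arranged in decreasing order (with multiplicity); set $a_0=+\infty$, $a_{K+1}=-\infty$. For $j=0,\dots,K$, $$S_j=\Big\{v\in C[-T,T]:\ a_{j+1}(x)\le v(x)\le a_j(x)\ \forall x\in[-T,T],\ \int_{-T}^T v(x)\,dx=A\Big\}.$$ *)

(* Defs.v *)
From mathcomp Require Import all_boot all_order all_algebra.
From mathcomp Require Import all_classical all_reals all_analysis.
From mathcomp Require Import zify ring lra.

Set Implicit Arguments.
Unset Strict Implicit.
Unset Printing Implicit Defensive.

Import Order.TTheory GRing.Theory Num.Theory.
Import numFieldNormedType.Exports.

Local Open Scope classical_set_scope.
Local Open Scope ring_scope.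

(* In ring_scope these otherwise denote derivatives of polynomials. *)
Local Notation "f ^` ()" := (derive1 f) : ring_scope.
Local Notation "f ^` ( n )" := (derive1n n f) : ring_scope.

(* A function on an interval or on the strip [0, T] x R is represented by a
   total function of which only the values on that set matter: the notions
   below are insensitive to the values elsewhere. *)

Section Regularity.
Context {R : realType}.

Definition smooth (f : R -> R) : Prop :=
  forall n x, derivable (f^`(n)) x 1.

Definition diff_quot (f : R -> R) (x y : R) : R := (f y - f x) / (y - x).

(* Derivative of f at x along D; it is one-sided at the endpoints when D is a
   closed interval. *)
Definition derivable_within (D : set R) (f : R -> R) (x : R) : Prop :=
  cvg (diff_quot f x @ within D x^').

Definition derive_within (D : set R) (f : R -> R) (x : R) : R :=
  lim (diff_quot f x @ within D x^').

Definition C0_itv (a b : R) (v : R -> R) : Prop :=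
  {within `[a, b], continuous v}.

Definition C1_itv (a b : R) (v : R -> R) : Prop :=
  (forall x, x \in `[a, b] -> derivable_within `[a, b] v x) /\
  C0_itv a b (derive_within `[a, b] v).

Definition C0_strip (T : R) (u : R -> R -> R) : Prop :=
  {within `[0, T] `*` setT, continuous (fun p : R * R => u p.1 p.2)}.

Definition dt (T : R) (u : R -> R -> R) (t x : R) : R :=
  derive_within `[0, T] (fun s => u s x) t.

Definition dx (u : R -> R -> R) (t x : R) : R := (u t)^`() x.

Fixpoint Ck_strip (T : R) (k : nat) (u : R -> R -> R) : Prop :=
  if k is m.+1 then
    [/\ C0_strip T u,
        forall t x, t \in `[0, T] ->
          derivable_within `[0, T] (fun s => u s x) t /\ derivable (u t) x 1,
        Ck_strip T m (dt T u)
      & Ck_strip T m (dx u)]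
  else C0_strip T u.

End Regularity.

Section TBVP.
Context {R : realType}.
Variables (T : R) (f0 fT : R -> R).

Definition int_itv (a b : R) (v : R -> R) : R :=
  \int[lebesgue_measure]_(s in `[a, b]) v s.

Definition L1norm (a b : R) (w : R -> R) : \bar R :=
  'N[lebesgue_measure]_1[EFin \o (w \_ `[a, b])]%E.

Lemma L1normE (a b : R) (w : R -> R) :
  L1norm a b w = (\int[lebesgue_measure]_(x in `[a, b]) `|w x|%:E)%E.
Proof.
rewrite /L1norm Lnorm1 [RHS]integral_mkcond; apply: eq_integral => x _ /=.
by rewrite patchE [in RHS]patchE; case: ifPn => //= _; rewrite normr0.
Qed.

Definition is_solution (u : R -> R -> R) : Prop :=
  [/\ Ck_strip T 2 u,
      forall t x, t \in `[0, T] -> dt T (dt T u) t x - dx (dx u) t x = 0,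
      forall x, u 0 x = f0 x
    & forall x, u T x = fT x].

Definition input (u : R -> R -> R) (x : R) : R := dt T u 0 x.

Definition input_space : set (R -> R) :=
  [set w | exists2 u, is_solution u & w = input u].

(* Only used for 0 <= t, where x - t <= x + t. *)
Definition induced_sol (v : R -> R) (t x : R) : R :=
  (f0 (x + t) + f0 (x - t)) / 2 + int_itv (x - t) (x + t) v / 2.

Definition cA : R := 2 * fT 0 - f0 T - f0 (- T).
Definition c1 : R := 2 * fT^`() 0 - f0^`() T - f0^`() (- T).
Definition c2 : R := 2 * (fT^`(2)) 0 - (f0^`(2)) T - (f0^`(2)) (- T).

Definition is_hat (v vh : R -> R) : Prop :=
  (forall x, - T <= x < T -> vh x = v x) /\
  (forall x, vh (x + T) =
     vh (x - T) + 2 * fT^`() x - f0^`() (x + T) - f0^`() (x - T)).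

Definition hat (v : R -> R) : R -> R := get [set vh | is_hat v vh].

Section Metric.
Variables K1 K2 : nat.

Definition nb_pieces : nat := (K1 + K2 + 1)%N.

Definition input_norm (w : R -> R) : \bar R :=
  L1norm (- ((2 * K1%:R + 1) * T)) ((2 * K2%:R + 1) * T) w.

Definition is_MS (u : R -> R -> R) : Prop :=
  is_solution u /\
  forall w, input_space w -> (input_norm (input u) <= input_norm w)%E.

Definition J1 (v : R -> R) : \bar R := input_norm (hat v).

Definition C_integral_A : set (R -> R) :=
  [set v | C0_itv (- T) T v /\ int_itv (- T) T v = cA].

Definition J1_minimizer (v : R -> R) : Prop :=
  C_integral_A v /\ forall w, C_integral_A w -> (J1 v <= J1 w)%E.

Definition t_right (k : nat) (x : R) : R :=
  f0^`() x + 2 * (\sum_(0 <= n < k) f0^`() (x + (2 * k%:R - 2 * n%:R) * T))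
  - 2 * (\sum_(0 <= n < k) fT^`() (x + (2 * k%:R - 2 * n%:R - 1) * T))
  - f0^`() (x + 2 * k%:R * T).

Definition t_left (k : nat) (x : R) : R :=
  f0^`() x
  + 2 * (\sum_(0 <= n < k) fT^`() (x + (2 * n%:R + 1 - 2 * k%:R) * T))
  - 2 * (\sum_(0 <= n < k) f0^`() (x + 2 * (n%:R + 1 - k%:R) * T))
  - f0^`() (x - 2 * k%:R * T).

Definition t_fun (i : nat) (x : R) : R :=
  if (i <= 1)%N then 0
  else if (i <= K2.+1)%N then t_right i.-1 x
  else t_left (i - K2.+1) x.

Definition sorted_values (x : R) : seq R :=
  sort >=%R [seq t_fun i x | i <- iota 1 nb_pieces].

(* The index 0 gives +oo, and nb_pieces.+1 is past the end of the list. *)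
Definition a_ (j : nat) (x : R) : \bar R :=
  nth -oo%E (+oo%E :: [seq y%:E | y <- sorted_values x]) j.

Definition S_ (j : nat) : set (R -> R) :=
  [set v | [/\ C0_itv (- T) T v,
               forall x, x \in `[- T, T] -> (a_ j.+1 x <= (v x)%:E <= a_ j x)%E
             & int_itv (- T) T v = cA]].

Definition C1_compatible (v : R -> R) : Prop :=
  [/\ C1_itv (- T) T v,
      v T = v (- T) + c1
    & derive_within `[- T, T] v T = derive_within `[- T, T] v (- T) + c2].

End Metric.

(* is_hat v holds of exactly one function, hence of hat v. *)

Hypothesis T_gt0 : 0 < T.

Lemma is_hat_exists (v : R -> R) : exists vh, is_hat v vh.
Proof.
pose h x := 2 * fT^`() (x - T) - f0^`() x - f0^`() (x - 2 * T).
pose P (n : int) y : R := match n with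
  | Posz n => \sum_(0 <= k < n) h (y + 2 * T * k.+1%:R)
  | Negz n => - \sum_(0 <= k < n.+1) h (y - 2 * T * k%:R) end.
have P0 y : P 0 y = 0 by rewrite [LHS](_ : _ = P (Posz 0) y) // /P big_geq.
have PS n y : P (n + 1) y = P n y + h (y + 2 * T * (n + 1)%:~R).
  case: n => [n|[|n]].
  - by rewrite -PoszD addn1 /P big_nat_recr.
  - have -> : Negz 0 + 1 = 0 by [].
    by rewrite P0 /P big_nat1 !mulr0 addr0 subr0 addNr.
  - have -> : Negz n.+1 + 1 = Negz n by rewrite !NegzE; lia.
    rewrite /P [in RHS]big_nat_recr //= NegzE mulrNz mulrN opprD.
    by rewrite -addrA addNr addr0.
pose n x := Num.floor ((x + T) / (2 * T)).
pose y x := x - 2 * T * (n x)%:~R.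
have T_neq0 : T != 0 by rewrite gt_eqF.
exists (fun x => v (y x) + P (n x) (y x)); split=> x.
  move=> xT; have nx : n x = 0.
    apply: floor_def; rewrite ler_pdivlMr ?ltr_pdivrMr; lra.
  have yx : y x = x by rewrite /y nx mulr0 subr0.
  by rewrite nx yx P0 addr0.
have nx : n (x + T) = n (x - T) + 1.
  rewrite /n (_ : (x + T + T) / (2 * T) = (x - T + T) / (2 * T) + 1).
    by rewrite floorDrz ?floor1.
  by field.
have yx : y (x + T) = y (x - T).
  by rewrite /y nx intrD; ring.
rewrite nx yx PS -[in X in h X]nx (_ : y (x - T) + _ = x + T).
  by rewrite /h addrK (_ : x + T - 2 * T = x - T); ring.
by rewrite -yx /y subrK.
Qed.

Lemma is_hat_unique (v g1 g2 : R -> R) :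
  is_hat v g1 -> is_hat v g2 -> g1 = g2.
Proof.
move=> [v1 e1] [v2 e2].
have per x : g1 (x + 2 * T) - g2 (x + 2 * T) = g1 x - g2 x.
  have := e1 (x + T); have := e2 (x + T).
  by rewrite addrK (_ : x + T + T = x + 2 * T); [move=> -> ->; ring|ring].
have pern x (n : nat) :
    g1 (x + 2 * T * n%:R) - g2 (x + 2 * T * n%:R) = g1 x - g2 x.
  elim: n => [|n IH]; first by rewrite mulr0 addr0.
  by rewrite -[RHS]IH -[RHS]per -(natr1 n) mulrDr mulr1 addrA.
have perz x (n : int) :
    g1 (x + 2 * T * n%:~R) - g2 (x + 2 * T * n%:~R) = g1 x - g2 x.
  case: n => n; first exact: pern.
  by rewrite NegzE mulrNz -(pern _ n.+1) mulrN subrK.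
apply/funext => x; apply/eqP; rewrite -subr_eq0; apply/eqP.
pose n := Num.floor ((x + T) / (2 * T)).
rewrite -(perz x (- n)) mulrNz mulrN.
have /andP[] := floor_itv ((x + T) / (2 * T)).
have T2_gt0 : 0 < 2 * T by rewrite mulr_gt0.
rewrite -/n ler_pdivlMr // ltr_pdivrMr // intrD.
move: (n%:~R : R) => m ml mr.
have yT : - T <= x - 2 * T * m < T by apply/andP; split; nra.
by rewrite v1 // v2 // subrr.
Qed.

Lemma hatP (v : R -> R) : is_hat v (hat v).
Proof. exact: getPex (is_hat_exists v). Qed.

End TBVP.

(* Main.v *)
Require Import Defs.
From mathcomp Require Import all_boot all_order all_algebra.
From mathcomp Require Import all_classical all_reals all_analysis.
From mathcomp Require Import measurable_realfun zify ring lra.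

Set Implicit Arguments.
Unset Strict Implicit.
Unset Printing Implicit Defensive.

Import Order.TTheory GRing.Theory Num.Theory.
Import numFieldNormedType.Exports.

Local Open Scope ring_scope.
Local Open Scope classical_set_scope.

(* In ring_scope these otherwise denote derivatives of polynomials. *)
Local Notation "f ^` ()" := (derive1 f) : ring_scope.
Local Notation "f ^` ( n )" := (derive1n n f) : ring_scope.

(** The problem reduces to a pointwise one. The interval of the norm is
    made up of [K = K1 + K2 + 1] translates of [[- T, T]], on each of which [hat v]
    is a translate of one of the [v - t_i] ([hat_right], [hat_left]), so [J1 v] is the integral over [[- T, T]]
    of the sum over [i] of the distances [|v x - t_i x|] ([J1E]). For fixed [x] this
    sum is a convex piecewise linear function of [v x], whose slope between the
    sorted values [a_{j+1} x] and [a_j x] is [K - 2 j]. Subtracting the linear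
    function with that slope leaves, up to a constant, a nonnegative excess that
    vanishes exactly on [[a_{j+1} x, a_j x]] ([sum_dist_excess],
    [excess_eq0_nth]). Since competitors have the same integral [A], the linear
    term integrates to the same value for all of them; hence an element of [S_ j]
    minimizes [J1], and a function with the same value of [J1] has zero excess,
    by continuity at every point, so it is in the same [S_ j] ([S_compare]). Some
    [S_ j] is nonempty because the sorted values are continuous in [x] and their
    integrals decrease with [j]: [A] lies between two consecutive integrals or
    beyond the extreme ones ([S_nonempty]).

    The link with the wave equation has two directions. For a solution [u], the
    functions [u_t - u_x] and [u_t + u_x] are constant along characteristics
    ([characteristic]); comparing times [0] and [T] shows that the input is its own
    extension, has integral [A] over [[- T, T]], and is C^1 and compatible at the
    endpoints ([input_is_hat], [input_integral], [input_compatible]). Conversely,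
    if [v] has integral [A], is C^1 and satisfies the two endpoint conditions, then
    [hat v] is C^1 on the line ([hat_is_derive]), and the induced travelling wave
    is a solution with input [hat v] ([induced_is_solution]). So the norms of
    inputs are the values of [J1] at the compatible functions, and these functions
    are dense enough in [L^1] for the infimum over inputs to be the minimum of [J1]
    ([C1_L1_approx], [minimum_eq_inf]). A minimum-input solution is thus a solution
    whose input minimizes [J1], that is, one induced by a compatible element of
    some [S_ j]. *)

(** * Integrals of continuous functions and primitives *)

Section Integral.
Context {R : realType}.
Implicit Types (f g F : R -> R) (a b c x : R).

Lemma integrable_itv a b f : continuous f ->
  lebesgue_measure.-integrable `[a, b] (EFin \o f).
Proof.
move=> cf; apply: continuous_compact_integrable; first exact: segment_compact.
exact: continuous_subspaceT.
Qed.

Lemma int_itvxx a f : int_itv a a f = 0.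
Proof. by rewrite /int_itv set_itv1 Rintegral_set1. Qed.

Lemma eq_int_itv a b f g :
  (forall x, a <= x <= b -> f x = g x) -> int_itv a b f = int_itv a b g.
Proof.
by move=> fg; apply: eq_Rintegral => x; rewrite inE /= in_itv /= => /fg.
Qed.

Lemma int_itvD a b f g : continuous f -> continuous g ->
  int_itv a b (fun x => f x + g x) = int_itv a b f + int_itv a b g.
Proof. by move=> cf cg; apply: RintegralD => //; exact: integrable_itv. Qed.

Lemma int_itvB a b f g : continuous f -> continuous g ->
  int_itv a b (fun x => f x - g x) = int_itv a b f - int_itv a b g.
Proof. by move=> cf cg; apply: RintegralB => //; exact: integrable_itv. Qed.

Lemma int_itvZ a b k f : continuous f ->
  int_itv a b (fun x => k * f x) = k * int_itv a b f.
Proof. by move=> cf; apply: RintegralZl => //; exact: integrable_itv. Qed.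

Lemma le_int_itv a b f g : continuous f -> continuous g ->
  (forall x, a <= x <= b -> f x <= g x) -> int_itv a b f <= int_itv a b g.
Proof.
by move=> cf cg fg; apply: le_Rintegral => //; exact: integrable_itv.
Qed.

Lemma int_itv_split a b c f : continuous f -> a <= b -> b <= c ->
  int_itv a c f = int_itv a b f + int_itv b c f.
Proof.
move=> cf ab bc; apply/eqP; rewrite addrC -subr_eq; apply/eqP.
rewrite /int_itv Rintegral_itvB ?bnd_simp//; last exact: integrable_itv.
rewrite Rintegral_itv_obnd_cbnd//.
apply: integrableS (@integrable_itv b c f cf) => //.
by move=> x /=; rewrite !in_itv /= => /andP[/ltW -> ->].
Qed.

Lemma is_derive_continuous f (df : R -> R) :
  (forall x, is_derive x 1 f (df x)) -> continuous f.
Proof.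
by move=> fd x; apply/differentiable_continuous/derivable1_diffP; case: (fd x).
Qed.

Lemma int_itvE a b f F : a <= b -> continuous f ->
  (forall x, is_derive x 1 F (f x)) -> int_itv a b f = F b - F a.
Proof.
rewrite le_eqVlt => /predU1P[->|ab] cf Ff; first by rewrite int_itvxx subrr.
rewrite /int_itv /Rintegral (@continuous_FTC2 _ f F)//.
- exact: continuous_subspaceT.
- split.
  + by move=> x _; case: (Ff x).
  + exact/cvg_at_right_filter/(is_derive_continuous Ff).
  + exact/cvg_at_left_filter/(is_derive_continuous Ff).
- by move=> x _; rewrite derive1E; have [_ ->] := Ff x.
Qed.

Lemma int_itv_cst a b k : a <= b -> int_itv a b (fun=> k) = k * (b - a).
Proof.
move=> ab; have d x : is_derive x 1 (fun x : R => k * x) k.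
  by apply: is_derive_eq; rewrite /GRing.scale /= mulr1.
by rewrite (int_itvE ab (@cst_continuous _ _ k) d) mulrBr.
Qed.

Lemma int_itv_ge0 a b f : (forall x, a <= x <= b -> 0 <= f x) ->
  0 <= int_itv a b f.
Proof.
by move=> f0; apply: Rintegral_ge0 => x /=; rewrite in_itv /= => /f0.
Qed.

(** The integral from a base point has derivative [f x] only to the right of that
    point, so the base point is taken to the left of [x]; additivity of the
    integral shows that the normalized value does not depend on it. *)
Lemma primitive_exists f : continuous f ->
  exists F, forall x, is_derive x 1 F (f x).
Proof.
move=> cf; pose a0 x := Order.min x 0 - 1.
pose F x := int_itv (a0 x) x f - int_itv (a0 x) 0 f.
have FE a x : a <= x -> a <= 0 -> F x = int_itv a x f - int_itv a 0 f.
  move=> ax a00; rewrite /F.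
  have spl b d c : b <= d -> d <= c -> int_itv b c f = int_itv b d f + int_itv d c f.
    exact: int_itv_split.
  have a0x : a0 x <= x by rewrite lerBlDr ge_min ler_wpDr.
  have a0x0 : a0 x <= 0 by rewrite lerBlDr ge_min [in X in _ || X]ler_wpDr ?orbT.
  have [aa0|/ltW a0a] := leP a (a0 x).
    by rewrite (spl a (a0 x) x) // (spl a (a0 x) 0) //; ring.
  by rewrite (spl (a0 x) a x) // (spl (a0 x) a 0) //; ring.
exists F => x; pose a := Order.min x 0 - 2.
have ax : a < x by rewrite ltrBlDr gt_min ltrDl ltr0n.
have a00 : a <= 0 by rewrite lerBlDr ge_min [in X in _ || X]ler_wpDr ?orbT.
apply: (@near_eq_is_derive _ _ _ (fun x => int_itv a x f - int_itv a 0 f)).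
  near=> y; rewrite (FE a) //; apply: ltW; near: y.
  exact: lt_nbhsr.
have x1 : x < x + 1 by rewrite ltrDl.
have [d1 d2] := continuous_FTC1_closed x1 (integrable_itv a _ cf) ax (cf x).
have : is_derive x 1 (fun x => int_itv a x f) (f x).
  by split; [exact: d1|rewrite -d2 derive1E].
move=> d; apply: is_derive_eq; rewrite subr0; reflexivity.
Unshelve. all: by end_near. Qed.

End Integral.

(** * One-sided derivatives and continuity on a segment *)

Section Derivatives.
Context {R : realType}.
Implicit Types (f g F : R -> R) (a b c x : R).

Lemma is_derive_diff_quot f x d :
  is_derive x 1 f d <-> diff_quot f x @ x^' --> d.
Proof.
have eqE : ((fun h => h^-1 *: ((f \o shift x) (h *: (1 : R)) - f x)) @ 0^' --> d)
    <-> (diff_quot f x @ x^' --> d).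
  split=> /cvgrPdist_le H; apply/cvgrPdist_le => e /H {H}.
    move=> /nbhs_ballP[r /= r0 H]; apply/nbhs_ballP; exists r => //= z xz zx.
    have zx0 : z - x != 0 by rewrite subr_eq0.
    have /H/(_ zx0) : ball (0 : R) r (z - x).
      by move: xz; rewrite /ball /= sub0r opprB.
    by rewrite /diff_quot [_ *: 1]mulr1 /= subrK [_^-1 *: _]mulrC.
  move=> /nbhs_ballP[r /= r0 H]; apply/nbhs_ballP; exists r => //= z xz z0.
  have zx : z + x != x by rewrite -subr_eq0 addrK.
  have /H/(_ zx) : ball x r (z + x).
    by move: xz; rewrite /ball /= sub0r opprD addrCA subrr addr0.
  by rewrite /diff_quot addrK [_ *: 1]mulr1 /= [_^-1 *: _]mulrC.
rewrite -eqE; split => [[dv <-]|c]; first exact: dv.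
by split; [exact: cvgP c|apply/cvg_lim => //; exact: Rhausdorff].
Qed.

Lemma within_itv_dnbhs a b x : a < x < b -> within `[a, b] x^' = x^'.
Proof.
move=> /andP[ax xb]; apply/seteqP; split=> P H; last first.
  by move: H; rewrite /dnbhs /within /=; apply: filterS => y H yx _; exact: H.
have {}H : \forall y \near x, y != x -> a <= y <= b -> P y by exact: H.
suff : \forall y \near x, y != x -> P y by [].
near=> y => yx; apply: (near H y) => //.
apply/andP; split; apply: ltW; near: y.
  exact: lt_nbhsr.
exact: lt_nbhsl.
Unshelve. all: by end_near. Qed.

Lemma derivable_within_itvoo a b f x : a < x < b ->
  derivable_within `[a, b] f x ->
  is_derive x 1 f (derive_within `[a, b] f x).
Proof.
move=> axb df; apply/is_derive_diff_quot.
by move: df; rewrite /derivable_within /derive_within within_itv_dnbhs.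
Qed.

(** Gives uniqueness of limits, hence of one-sided derivatives, at every point of
    a nondegenerate segment. *)
Lemma within_itv_dnbhs_proper a b x : a < b -> a <= x <= b ->
  ProperFilter (within `[a, b] x^').
Proof.
move=> ab /andP[ax xb]; split; last exact: within_filter.
rewrite /within /= /dnbhs /within /= => /nbhs_ballP[e /= e0 H].
have [xb'|bx] := ltP x b.
  pose d := Order.min (e / 2) (b - x).
  have d0 : 0 < d by rewrite lt_min subr_gt0 xb' divr_gt0.
  have de : d < e by rewrite gt_min; apply/orP; left; lra.
  have db : d <= b - x by rewrite ge_min lexx orbT.
  apply: (H (x + d)); rewrite /= ?in_itv /=.
  - by rewrite /ball /= opprD addNKr normrN gtr0_norm.
  - by rewrite -subr_eq0 addrAC subrr add0r gt_eqF.
  - lra.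
pose d := Order.min (e / 2) (b - a).
have d0 : 0 < d by rewrite lt_min subr_gt0 ab divr_gt0.
have de : d < e by rewrite gt_min; apply/orP; left; lra.
have db : d <= b - a by rewrite ge_min lexx orbT.
apply: (H (x - d)); rewrite /= ?in_itv /=.
- by rewrite /ball /= opprB addrCA subrr addr0 gtr0_norm.
- by rewrite -subr_eq0 addrAC subrr add0r oppr_eq0 gt_eqF.
- lra.
Qed.

Lemma is_derive_within a b f x d : a < b -> a <= x <= b -> is_derive x 1 f d ->
  derivable_within `[a, b] f x /\ derive_within `[a, b] f x = d.
Proof.
move=> ab axb /is_derive_diff_quot fd.
have c : diff_quot f x @ within `[a, b] x^' --> d by exact: cvg_within_filter fd.
have P := within_itv_dnbhs_proper ab axb.
by split; [exact: cvgP c|apply/cvg_lim => //; exact: Rhausdorff].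
Qed.

Lemma eq_diff_quot_within a b f g x : a <= x <= b ->
  (forall y, a <= y <= b -> f y = g y) ->
  diff_quot f x @ within `[a, b] x^' = diff_quot g x @ within `[a, b] x^'.
Proof.
move=> axb fg; apply/seteqP; split=> P H.
  have {}H : \forall y \near x, y != x -> a <= y <= b -> P (diff_quot f x y).
    exact: H.
  suff : \forall y \near x, y != x -> a <= y <= b -> P (diff_quot g x y) by [].
  apply: filterS H => y H yx yab; have := H yx yab.
  by rewrite /diff_quot !fg.
have {}H : \forall y \near x, y != x -> a <= y <= b -> P (diff_quot g x y).
  exact: H.
suff : \forall y \near x, y != x -> a <= y <= b -> P (diff_quot f x y) by [].
apply: filterS H => y H yx yab; have := H yx yab.
by rewrite /diff_quot !fg.
Qed.

Lemma eq_derive_within a b f g x : a <= x <= b ->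
  (forall y, a <= y <= b -> f y = g y) ->
  (derivable_within `[a, b] f x = derivable_within `[a, b] g x) *
  (derive_within `[a, b] f x = derive_within `[a, b] g x).
Proof.
by move=> axb fg; rewrite /derivable_within /derive_within (eq_diff_quot_within axb fg).
Qed.

Lemma C0_itv_continuous a b f : continuous f -> C0_itv a b f.
Proof. exact: continuous_subspaceT. Qed.

Lemma eq_C0_itv a b f g : (forall x, a <= x <= b -> f x = g x) ->
  C0_itv a b f -> C0_itv a b g.
Proof.
move=> fg; apply: subspace_eq_continuous => x.
by rewrite inE /= in_itv /= => /fg.
Qed.

Lemma is_derive0_itv_eq a b f : a <= b -> C0_itv a b f ->
  (forall x, a < x < b -> is_derive x 1 f 0) -> f b = f a.
Proof.
move=> ab cf f0; have f0' x : x \in `]a, b[%R -> is_derive x 1 f 0.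
  by rewrite in_itv /= => /f0.
have [c _] := @MVT_segment R f (fun=> 0) a b ab f0' cf.
by rewrite mul0r => /eqP; rewrite subr_eq0 => /eqP.
Qed.

(** The extension of the restriction of [f] to [[a, b]] by its boundary values. It
    turns continuity on a segment into continuity on the line, and so gives
    access to primitives. *)
Definition clamp a b f x := f (Order.max a (Order.min x b)).

Lemma clampE a b f x : a <= x <= b -> clamp a b f x = f x.
Proof. by move=> /andP[ax xb]; rewrite /clamp min_l // max_r. Qed.

Lemma clamp_continuous a b f : a <= b -> C0_itv a b f -> continuous (clamp a b f).
Proof.
move=> ab /subspace_continuousP cf x; rewrite /clamp.
pose k (y : R) : R := Order.max a (Order.min y b).
have kab y : `[a, b]%classic (k y).
  by rewrite /= in_itv /= le_max lexx /= ge_max ab ge_min lexx orbT.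
have ck : {for x, continuous k}.
  have cm : {for x, continuous (fun y : R => Order.min y b : R)}.
    exact: (@continuous_min R R id (cst b) x (fun _ => id) (@cst_continuous _ _ b x)).
  exact: (@continuous_max R R (cst a) _ x (@cst_continuous _ _ a x) cm).
have kw : k @ x --> within `[a, b] (nbhs (k x)).
  move=> P wP; have /ck : \forall z \near k x, `[a, b]%classic z -> P z by exact: wP.
  by rewrite /= !nbhs_simpl /=; apply: filterS => y; apply; exact: kab.
exact: (cvg_comp _ _ kw (cf _ (kab x))).
Qed.

(** A primitive is nondecreasing with equal values at both ends, hence constant
    on the interval, so its derivative there vanishes. *)
Lemma int_itv_eq0 a b f : a < b -> continuous f ->
  (forall x, a <= x <= b -> 0 <= f x) -> int_itv a b f = 0 ->
  forall x, a <= x <= b -> f x = 0.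
Proof.
move=> ab cf f0 i0; have [F dF] := primitive_exists cf.
have sub x y : a <= x -> x <= y -> y <= b -> F y - F x = int_itv x y f.
  by move=> ax xy yb; rewrite (int_itvE xy cf dF).
have F0 x y : a <= x -> x <= y -> y <= b -> 0 <= F y - F x.
  move=> ax xy yb; rewrite sub //; apply: int_itv_ge0 => z /andP[xz zy].
  by apply: f0; lra.
have Fab : F b - F a = 0 by rewrite sub ?i0 // ltW.
have FE x : a <= x <= b -> F x = F a.
  move=> /andP[ax xb]; have := F0 a x (lexx a) ax xb.
  by have := F0 x b ax xb (lexx b); move: Fab; lra.
move=> x axb; have [_ <-] := is_derive_within ab axb (dF x).
rewrite (eq_derive_within axb FE).2.
by have [_ ->] := is_derive_within ab axb (is_derive_cst (F a) x 1).
Qed.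

End Derivatives.

(** * Differentiation on the strip *)

Section Strip.
Context {R : realType}.
Implicit Types (g gx : R -> R -> R) (t x a c T : R).

Lemma MVT_is_derive (f df : R -> R) (a b : R) : a < b ->
  (forall x, a <= x <= b -> is_derive x 1 f (df x)) ->
  exists2 c, a < c < b & f b - f a = df c * (b - a).
Proof.
move=> ab fd; have [x|x|c] := @MVT R f df a b ab.
- by rewrite in_itv /= => /andP[ax xb]; apply: fd; rewrite !ltW.
- apply: derivable_within_continuous => y; rewrite in_itv /= => yab.
  by case: (fd y yab).
- by rewrite in_itv /= => cab e; exists c.
Qed.

Lemma MVT_dist (f df : R -> R) (x y : R) : (forall z : R, is_derive z 1 f (df z)) ->
  exists2 z, `|z - x| <= `|y - x| & f y - f x = df z * (y - x).
Proof.
move=> fd; case: (ltgtP x y) => [xy|yx|<-].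
- have [z /andP[xz zy] e] := MVT_is_derive xy (fun z _ => fd z).
  by exists z => //; rewrite !ger0_norm ?subr_ge0 ?(ltW xz) ?(ltW xy)//; lra.
- have [z /andP[xz zy] e] := MVT_is_derive yx (fun z _ => fd z).
  exists z; last by rewrite -[LHS]opprB e; ring.
  by rewrite !ler0_norm ?subr_le0 ?(ltW yx) ?(ltW zy)//; lra.
- by exists x; rewrite ?subrr ?mulr0.
Qed.

Definition continuous2_at g t x := forall e, 0 < e -> exists2 d, 0 < d &
  forall s y, `|s - t| < d -> `|y - x| < d -> `|g s y - g t x| < e.

Lemma C0_strip_continuous2_at T g t x : C0_strip T g -> 0 < t < T ->
  continuous2_at g t x.
Proof.
move=> /subspace_continuousP cg /andP[t0 tT] e e0.
have /(cg (t, x)) : (`[0, T] `*` setT) (t, x).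
  by split => //=; rewrite in_itv /= !ltW.
move=> /cvgrPdist_lt/(_ e e0)/nbhs_ballP[d /= d0 H].
exists (Order.min d (Order.min t (T - t))).
  by rewrite !lt_min d0 t0 subr_gt0.
move=> s y; rewrite !lt_min => /and3P[sd st sT] /andP[yd _].
rewrite distrC; apply: (H (s, y)).
  by split; rewrite /ball /= distrC.
split => //=; rewrite in_itv /=.
by move: st sT; rewrite !ltr_norml; lra.
Qed.

Lemma C0_strip_path T g a c : C0_strip T g ->
  C0_itv 0 T (fun t => g t (a + c * t)).
Proof.
move=> /subspace_continuousP cg; apply/subspace_continuousP => t t0T.
pose k (t : R) : R * R := (t, a + c * t).
have kw : k @ within `[0, T] (nbhs t) --> within (`[0, T] `*` setT) (nbhs (k t)).
  have ck : {for t, continuous k}.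
    have c2 : (fun s : R => a + c * s) @ t --> a + c * t.
      by apply: cvgD; [exact: cvg_cst|apply: cvgM; [exact: cvg_cst|exact: cvg_id]].
    exact: (cvg_pair (@cvg_id _ (nbhs t)) c2).
  move=> P wP; have /ck : \forall z \near k t, (`[0, T]%classic `*` setT) z -> P z.
    exact: wP.
  move=> H; suff : \forall y \near t, `[0, T]%classic y -> P (k y) by [].
  by move: H; rewrite /= !nbhs_simpl /=; apply: filterS => y + yT; apply.
have := cvg_comp _ _ kw (cg (k t) _); apply.
by split.
Qed.

(** The increment along the path is a displacement in [x] at the new time, which
    the mean value theorem expresses by a nearby value of [gx], followed by a
    change of time at the old place. *)
Lemma is_derive_path T g gx t a c d : 0 < t < T ->
  (forall s x, 0 < s < T -> is_derive x 1 (g s) (gx s x)) ->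
  continuous2_at gx t (a + c * t) ->
  is_derive t 1 (fun s => g s (a + c * t)) d ->
  is_derive t 1 (fun s => g s (a + c * s)) (d + c * gx t (a + c * t)).
Proof.
move=> t0T dg cgx /is_derive_diff_quot dgt; apply/is_derive_diff_quot.
pose A s := (g s (a + c * s) - g s (a + c * t)) / (s - t).
have -> : diff_quot (fun s => g s (a + c * s)) t =
    fun s => diff_quot (fun s => g s (a + c * t)) t s + A s.
  by apply/funext => s; rewrite /A /diff_quot -mulrDl; congr (_ * _); ring.
apply: cvgD; first exact: dgt.
apply/cvgrPdist_lt => e e0.
have c1 : 0 < `|c| + 1 by rewrite ltr_wpDl.
have [|r r0 H] := cgx (e / (`|c| + 1)); first by rewrite divr_gt0.
suff : \forall s \near t, s != t -> `|c * gx t (a + c * t) - A s| < e by [].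
have [t0 tT] := andP t0T.
near=> s => st.
have s0T : 0 < s < T.
  by apply/andP; split; near: s; [exact: lt_nbhsr|exact: lt_nbhsl].
have [z zs Ez] := MVT_dist (a + c * t) (a + c * s) (fun x => dg s x s0T).
have sr : `|s - t| < r / (`|c| + 1).
  rewrite distrC; near: s.
  by apply/nbhs_ballP; exists (r / (`|c| + 1)) => //=; rewrite divr_gt0.
have -> : A s = c * gx s z.
  by rewrite /A Ez; field; rewrite subr_eq0.
rewrite -mulrBr normrM.
have Hz : `|gx s z - gx t (a + c * t)| < e / (`|c| + 1).
  apply: H.
    by apply: lt_le_trans sr _; rewrite ler_pdivrMr //; have := normr_ge0 c; nra.
  apply: le_lt_trans zs _; rewrite (_ : _ - _ = c * (s - t)); last by ring.
  rewrite normrM; apply: (@le_lt_trans _ _ ((`|c| + 1) * `|s - t|)).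
    by rewrite ler_wpM2r // lerDl.
  by rewrite mulrC -ltr_pdivlMr.
rewrite distrC; apply: (@le_lt_trans _ _ ((`|c| + 1) * `|gx s z - gx t (a + c * t)|)).
  by rewrite ler_wpM2r // lerDl.
by rewrite mulrC -ltr_pdivlMr.
Unshelve. all: by end_near. Qed.

(** Both mixed derivatives are limits of the same second difference quotient
    over shrinking squares. *)
Lemma mixed_derivatives_eq T (u ut ux utx uxt : R -> R -> R) t x : 0 < t < T ->
  (forall t x, 0 < t < T -> is_derive t 1 (fun s => u s x) (ut t x)) ->
  (forall t x, 0 < t < T -> is_derive x 1 (u t) (ux t x)) ->
  (forall t x, 0 < t < T -> is_derive x 1 (ut t) (utx t x)) ->
  (forall t x, 0 < t < T -> is_derive t 1 (fun s => ux s x) (uxt t x)) ->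
  continuous2_at utx t x -> continuous2_at uxt t x ->
  utx t x = uxt t x.
Proof.
move=> /andP[t0 tT] dut dux dutx duxt ctx cxt.
apply/eqP; rewrite -subr_eq0 -normr_le0; apply/ler_addgt0Pr => e e0.
have e2 : 0 < e / 2 by rewrite divr_gt0.
have [r1 r10 H1] := ctx _ e2; have [r2 r20 H2] := cxt _ e2.
pose h := Order.min (Order.min (r1 / 2) (r2 / 2)) ((T - t) / 2).
have h0 : 0 < h by rewrite !lt_min !divr_gt0 // subr_gt0.
have hr1 : h <= r1 / 2 by rewrite !ge_min lexx.
have hr2 : h <= r2 / 2 by rewrite !ge_min lexx orbT.
have hT : h <= (T - t) / 2 by rewrite !ge_min lexx !orbT.
clearbody h.
have [s1 s1h E1] : exists2 s, t < s < t + h &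
   (u (t + h) (x + h) - u (t + h) x) - (u t (x + h) - u t x) =
   (ut s (x + h) - ut s x) * (t + h - t).
  apply: (@MVT_is_derive (fun s => u s (x + h) - u s x)
    (fun s => ut s (x + h) - ut s x)); first by rewrite ltrDl.
  move=> s /andP[ts sth]; have s0T : 0 < s < T by lra.
  exact: is_deriveB (dut _ _ s0T) (dut _ _ s0T).
have s1T : 0 < s1 < T by lra.
have [y1 y1h E1'] := @MVT_is_derive (ut s1) (utx s1) x (x + h)
  ltac:(by rewrite ltrDl) (fun y _ => dutx s1 y s1T).
have [y2 y2h E2] : exists2 y, x < y < x + h &
   (u (t + h) (x + h) - u t (x + h)) - (u (t + h) x - u t x) =
   (ux (t + h) y - ux t y) * (x + h - x).
  apply: (@MVT_is_derive (fun y => u (t + h) y - u t y)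
    (fun y => ux (t + h) y - ux t y)); first by rewrite ltrDl.
  move=> y _; have t0T : 0 < t < T by lra.
  have th0T : 0 < t + h < T by lra.
  exact: is_deriveB (dux _ _ th0T) (dux _ _ t0T).
have [s2 s2h E2'] := @MVT_is_derive (fun s => ux s y2) (fun s => uxt s y2) t (t + h)
  ltac:(by rewrite ltrDl) (fun s sth => duxt s y2 ltac:(lra)).
have E : utx s1 y1 = uxt s2 y2.
  have h2 : h * h != 0 by rewrite mulf_neq0 // gt_eqF.
  have addhK z : z + h - z = h by rewrite addrAC subrr add0r.
  move: E1 E2; rewrite E1' E2' !addhK => E1 E2.
  by apply: (mulIf h2); rewrite !mulrA -E1 -E2; ring.
have F1 : `|utx s1 y1 - utx t x| < e / 2 by apply: H1; rewrite ger0_norm; lra.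
have F2 : `|uxt s2 y2 - uxt t x| < e / 2 by apply: H2; rewrite ger0_norm; lra.
rewrite add0r (_ : _ - _ = (uxt s2 y2 - uxt t x) - (utx s1 y1 - utx t x)); last first.
  by rewrite E; ring.
by apply: le_trans (ler_normB _ _) _; lra.
Qed.

End Strip.

(** * Inputs of solutions *)

Section Solutions.
Context {R : realType}.
Variables (T : R) (f0 fT : R -> R).
Hypothesis T_gt0 : 0 < T.

Lemma is_derive_derive1 (f : R -> R) (x : R) :
  derivable f x 1 -> is_derive x 1 f (f^`() x).
Proof. by move=> df; rewrite derive1E; exact: derivableP. Qed.

Lemma derive1_is_derive (f : R -> R) (x d : R) :
  is_derive x 1 f d -> f^`() x = d.
Proof. by move=> [_ <-]; rewrite derive1E. Qed.

Lemma smooth_is_derive (f : R -> R) : smooth f ->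
  forall n (x : R), is_derive x 1 (f^`(n)) (f^`(n.+1) x).
Proof. by move=> sf n x; rewrite derive1nS; exact/is_derive_derive1/sf. Qed.

Lemma is_derive_comp_affine (f : R -> R) (a c x d : R) :
  is_derive (a + c * x) 1 f d -> is_derive x 1 (fun y => f (a + c * y)) (c * d).
Proof.
move=> df; have da : is_derive x 1 (fun y : R => a + c * y) c.
  have := is_deriveD (is_derive_cst a x 1) (is_deriveZ c (is_derive_id x (1 : R))).
  by rewrite add0r [_ *: _]mulr1.
by rewrite mulrC; exact: (@is_derive1_comp _ f (fun y => a + c * y) x d c df da).
Qed.

(** By equality of mixed derivatives, the derivative of [u_t - c u_x] along the
    line [x = a + c t] is [u_tt - c ^ 2 u_xx], which the wave equation makes zero
    for [c = 1] and [c = -1]. *)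
Lemma characteristic u (c a t : R) : is_solution T f0 fT u -> c * c = 1 ->
  0 <= t <= T ->
  dt T u t (a + c * t) - c * dx u t (a + c * t) = dt T u 0 a - c * dx u 0 a.
Proof.
move=> [[c0u du [c0ut dut c0utt c0utx] [c0ux dux c0uxt c0uxx]] wave _ _] cc /andP[t0 tT].
pose p s := dt T u s (a + c * s) - c * dx u s (a + c * s).
have -> : dt T u 0 a - c * dx u 0 a = p 0 by rewrite /p mulr0 addr0.
have inT s : 0 < s < T -> s \in `[0, T]%R by rewrite in_itv /= => /andP[/ltW -> /ltW ->].
have dtP (g : R -> R -> R) s x : 0 < s < T ->
    derivable_within `[0, T] (fun s => g s x) s ->
    is_derive s 1 (fun s => g s x) (dt T g s x).
  exact: derivable_within_itvoo.
have sch s x : 0 < s < T -> dx (dt T u) s x = dt T (dx u) s x.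
  move=> sT; apply: (@mixed_derivatives_eq R T u (dt T u) (dx u)) => //.
  - by move=> {sT}s {}x sT; apply: dtP => //; case: (du s x (inT s sT)).
  - by move=> {sT}s {}x sT; apply: is_derive_derive1; case: (du s x (inT s sT)).
  - by move=> {sT}s {}x sT; apply: is_derive_derive1; case: (dut s x (inT s sT)).
  - by move=> {sT}s {}x sT; apply: dtP => //; case: (dux s x (inT s sT)).
  - exact: C0_strip_continuous2_at c0utx sT.
  - exact: C0_strip_continuous2_at c0uxt sT.
apply: (@is_derive0_itv_eq R 0 t p t0).
  apply: (@continuous_subspaceW _ _ _ `[0, T]).
    by move=> s /=; rewrite !in_itv /= => /andP[-> /le_trans]; apply.
  have c1 := @C0_strip_path R T _ a c c0ut; have c2 := @C0_strip_path R T _ a c c0ux.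
  move=> s; apply: cvgB; first exact: c1.
  by apply: cvgM; [exact: cvg_cst|exact: c2].
move=> s /andP[s0 st]; have sT : 0 < s < T by rewrite s0 (lt_le_trans st tT).
have d1 : is_derive s 1 (fun s => dt T u s (a + c * s))
    (dt T (dt T u) s (a + c * s) + c * dx (dt T u) s (a + c * s)).
  apply: (is_derive_path sT) => //.
  - by move=> r x rT; apply: is_derive_derive1; case: (dut r x (inT r rT)).
  - exact: C0_strip_continuous2_at c0utx sT.
  - by apply: dtP => //; case: (dut s (a + c * s) (inT s sT)).
have d2 : is_derive s 1 (fun s => dx u s (a + c * s))
    (dt T (dx u) s (a + c * s) + c * dx (dx u) s (a + c * s)).
  apply: (is_derive_path sT) => //.
  - by move=> r x rT; apply: is_derive_derive1; case: (dux r x (inT r rT)).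
  - exact: C0_strip_continuous2_at c0uxx sT.
  - by apply: dtP => //; case: (dux s (a + c * s) (inT s sT)).
apply: is_derive_eq.
rewrite /GRing.scale /= -sch // mulrDr mulrA cc mul1r.
have := wave s (a + c * s) (inT s sT) => /eqP; rewrite subr_eq0 => /eqP ->.
by rewrite [X in _ - X]addrC subrr.
Qed.

Lemma dx_boundary u t (f : R -> R) x : (forall x, u t x = f x) -> dx u t x = f^`() x.
Proof. by move=> uf; rewrite /dx (_ : u t = f) //; exact/funext. Qed.

Lemma input_C1 u : is_solution T f0 fT u ->
  (forall x : R, is_derive x 1 (input T u) (dx (dt T u) 0 x)) /\
  continuous (dx (dt T u) 0).
Proof.
move=> [[_ _ [_ dut _ c0utx] _] _ _ _].
have T0 : (0 : R) \in `[0, T]%R by rewrite in_itv /= lexx ltW.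
split=> x; first by apply: is_derive_derive1; case: (dut 0 x T0).
move: c0utx => /subspace_continuousP cg.
pose k (y : R) : R * R := (0, y).
have kw : k @ x --> within (`[0, T] `*` setT) (nbhs (k x)).
  have ck : {for x, continuous k}.
    exact: (cvg_pair (@cvg_cst _ 0 _ (nbhs x) _) (@cvg_id _ (nbhs x))).
  move=> P wP; have /ck : \forall z \near k x, (`[0, T]%classic `*` setT) z -> P z.
    exact: wP.
  by rewrite /= !nbhs_simpl /=; apply: filterS => y; apply.
exact: (cvg_comp _ _ kw (cg (k x) (conj T0 I))).
Qed.

(** The characteristics from [(0, x - T)] and [(0, x + T)] meet at [(T, x)], where
    they give the values of [u_t - u_x] and [u_t + u_x]; the difference of these
    is [2 fT'(x)]. *)
Lemma input_is_hat u : is_solution T f0 fT u ->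
  is_hat T f0 fT (input T u) (input T u).
Proof.
move=> su; have [_ _ u0 uT] := su; split=> // x.
have TT : 0 <= T <= T by rewrite lexx ltW.
have E1 := @characteristic u 1 (x - T) T su (mulr1 _) TT.
have NN1 : -1 * -1 = 1 :> R by rewrite mulrNN mulr1.
have E2 := @characteristic u (-1) (x + T) T su NN1 TT.
move: E1 E2; rewrite !(dx_boundary _ uT) !(dx_boundary _ u0) /input.
rewrite (_ : x - T + 1 * T = x); last by ring.
rewrite (_ : x + T + -1 * T = x); last by ring.
move: (dt T u T x) (dt T u 0 _) (dt T u 0 _) (fT^`() x) (f0^`() _) (f0^`() _).
by move=> *; lra.
Qed.

(** Along the line from [(0, T)] to [(T, 0)] the derivative of [u] at time [t] is
    [u_t - u_x], that is [v(T - 2t) - f0'(T - 2t)] with [v] the input. Integrating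
    it compares [fT 0] with [f0 T]. *)
Lemma input_integral u : smooth f0 -> is_solution T f0 fT u ->
  int_itv (- T) T (input T u) = cA T f0 fT.
Proof.
move=> sf0 su; have [dw cw'] := input_C1 su.
have cw := is_derive_continuous dw; have [W dW] := primitive_exists cw.
have NT : - T <= T by rewrite ge0_cp ?ltW.
rewrite (int_itvE NT cw dW).
have [[c0u du [c0ut dut _ _] [c0ux _ _ _]] wave u0 uT] := su.
have inT s : 0 < s < T -> s \in `[0, T]%R by rewrite in_itv /= => /andP[/ltW -> /ltW ->].
have df0 (x : R) : is_derive x 1 f0 (f0^`() x) by exact: (smooth_is_derive sf0 0 x).
have cf0 := is_derive_continuous df0; have cW := is_derive_continuous dW.
pose Z t := u t (T + -1 * t) + (W (T + -2 * t) - f0 (T + -2 * t)) / 2.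
have caff (c : R) : continuous (fun t : R => T + c * t).
  move=> t; apply: cvgD; first exact: cvg_cst.
  by apply: cvgM; [exact: cvg_cst|exact: cvg_id].
have ZT : Z T = Z 0.
  apply: is_derive0_itv_eq => //; first exact: ltW.
    have c1 := @C0_strip_path R T _ T (-1) c0u.
    have c2 : C0_itv 0 T (fun t => (W (T + -2 * t) - f0 (T + -2 * t)) / 2).
      apply: C0_itv_continuous => t; apply: cvgM; last exact: cvg_cst.
      by apply: cvgB; apply: continuous_comp;
        [exact: caff|exact: cW|exact: caff|exact: cf0].
    by move=> t; apply: cvgD; [exact: c1|exact: c2].
  move=> t tT.
  have d1 : is_derive t 1 (fun t => u t (T + -1 * t))
      (dt T u t (T + -1 * t) + -1 * dx u t (T + -1 * t)).
    apply: (is_derive_path tT).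
    - by move=> s x sT; apply: is_derive_derive1; case: (du s x (inT s sT)).
    - exact: C0_strip_continuous2_at c0ux tT.
    - by apply: (derivable_within_itvoo tT); case: (du t (T + -1 * t) (inT t tT)).
  have d2 := is_derive_comp_affine (dW (T + -2 * t)).
  have d3 := is_derive_comp_affine (df0 (T + -2 * t)).
  apply: is_derive_eq.
  have tT' : 0 <= t <= T by move: tT => /andP[/ltW -> /ltW ->].
  have := @characteristic u 1 (T + -2 * t) t su (mulr1 _) tT'.
  rewrite (_ : T + -2 * t + 1 * t = T + -1 * t); last by ring.
  rewrite (dx_boundary _ u0) /input /GRing.scale /=.
  lra.
move: ZT; rewrite /Z !mulr0 !addr0 (_ : T + -1 * T = 0); last by ring.
rewrite (_ : T + -2 * T = - T); last by ring.
rewrite uT u0 /cA; lra.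
Qed.

End Solutions.

(** * Continuity of the extension *)

Section Hat.
Context {R : realType}.
Variables (T : R) (f0 fT : R -> R).
Hypothesis T_gt0 : 0 < T.

(** The increment of an extension between [x - 2 T] and [x]. *)
Definition hat_jump (x : R) : R := 2 * fT^`() (x - T) - f0^`() x - f0^`() (x - 2 * T).

Lemma is_hat_shift (v vh : R -> R) x : is_hat T f0 fT v vh ->
  vh x = vh (x - 2 * T) + hat_jump x.
Proof.
move=> [_ hv]; have := hv (x - T); rewrite /hat_jump subrK => ->.
rewrite (_ : x - T - T = x - 2 * T); last by ring.
by rewrite -!addrA.
Qed.

Lemma continuous_at_translate (f : R -> R) (c x : R) : {for x + c, continuous f} ->
  {for x, continuous (fun y => f (y + c))}.
Proof.
move=> cf; apply: (@continuous_comp _ _ _ (fun y : R => y + c) f) => //.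
by apply: cvgD; [exact: cvg_id|exact: cvg_cst].
Qed.

Lemma near_eq_continuous_at (f g : R -> R) (x : R) : (\near x, f x = g x) ->
  {for x, continuous g} -> {for x, continuous f}.
Proof.
move=> fg cg; have e := nbhs_singleton fg; rewrite /prop_for /continuous_at e.
have gf : \forall y \near x, g y = f y by apply: filterS fg.
exact: (cvg_trans (near_eq_cvg gf) cg).
Qed.

Lemma continuous_hat_jump :
  continuous f0^`() -> continuous fT^`() -> continuous hat_jump.
Proof.
move=> cf0 cfT x.
apply: cvgB; last exact: (@continuous_at_translate _ (- (2 * T)) x (cf0 _)).
apply: cvgB; last exact: cf0.
by apply: cvgM; [exact: cvg_cst|exact: (@continuous_at_translate _ (- T) x (cfT _))].
Qed.

(** The two one-sided limits of [hat v] at an odd multiple of [T] agree because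
    [v T - v (- T)] is the jump prescribed at [x = T]. *)
Lemma is_hat_continuous (v vh : R -> R) : is_hat T f0 fT v vh ->
  continuous f0^`() -> continuous fT^`() ->
  C0_itv (- T) T v -> v T = v (- T) + c1 T f0 fT -> continuous vh.
Proof.
move=> hv cf0 cfT cv vT.
have NT : - T <= T by rewrite ge0_cp ?ltW.
have cc := clamp_continuous NT cv.
have ch := continuous_hat_jump cf0 cfT.
have hT : hat_jump T = c1 T f0 fT.
  by rewrite /hat_jump /c1 subrr (_ : T - 2 * T = - T) //; ring.
pose m (y : R) := Order.min y (- T) + 2 * T.
have cm : continuous m.
  move=> y; apply: cvgD; last exact: cvg_cst.
  exact: (@continuous_min R R id (cst (- T)) y (fun _ => id)
    (@cst_continuous _ _ (- T) y)).
(* A continuous function that is [vh] on both sides of [- T]: the arguments of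
   [clamp] and [m] make each term constant where it must not contribute. *)
pose w y := clamp (- T) T v y + clamp (- T) T v (y + 2 * T) - v T
            - hat_jump (m y) + hat_jump T.
have cw : continuous w.
  move=> y; apply: cvgD; last exact: cvg_cst.
  apply: cvgB; last by apply: continuous_comp; [exact: cm|exact: ch].
  apply: cvgB; last exact: cvg_cst.
  by apply: cvgD; [exact: cc|exact: (@continuous_at_translate _ (2 * T) y (cc _))].
have vE y : - (3 * T) < y < T -> vh y = w y.
  move=> /andP[y3 yT]; rewrite /w /m; have [yT'|yT'] := leP (- T) y.
    rewrite (hv.1 y); last by rewrite yT' yT.
    rewrite (@clampE _ _ _ _ y) ?yT' ?ltW // /clamp.
    rewrite (_ : Order.min (y + 2 * T) T = T); last by apply: min_r; lra.
    rewrite (max_r NT) (_ : - T + 2 * T = T); last by ring.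
    by ring.
  have yTT : - T <= y + 2 * T < T by lra.
  have := is_hat_shift (y + 2 * T) hv; rewrite addrK (hv.1 _ yTT) => E.
  rewrite (@clampE _ _ _ _ (y + 2 * T)); last by move: yTT => /andP[-> /ltW ->].
  rewrite {1}/clamp (_ : Order.min y T = y); last by apply: min_l; lra.
  rewrite (max_l (ltW yT')) vT hT E; ring.
have base x : - (3 * T) < x < T -> {for x, continuous vh}.
  move=> /andP[x3 xT]; apply: near_eq_continuous_at (cw x).
  near=> y; apply: vE; apply/andP; split; near: y; first exact: lt_nbhsr.
  exact: lt_nbhsl.
(* Shifts by [2 T] enlarge the interval of continuity by [2 T] on either side. *)
have all n x : - ((2 * n%:R + 3) * T) < x < (2 * n%:R + 1) * T ->
    {for x, continuous vh}.
  elim: n x => [|n IH] x.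
    by rewrite mulr0 !add0r mul1r; exact: base.
  rewrite -(natr1 n) => xn; have n0 : 0 <= n%:R :> R by [].
  have [xl|xl] := leP ((2 * n%:R + 1) * T) x.
    have -> : vh = (fun y => vh (y + - (2 * T)) + hat_jump y).
      by apply/funext => y; exact: is_hat_shift hv.
    apply: cvgD; last exact: ch.
    by apply: (@continuous_at_translate vh (- (2 * T)) x); apply: IH; nra.
  have [xr|xr] := leP x (- ((2 * n%:R + 3) * T)); last by apply: IH; rewrite xr xl.
  have -> : vh = (fun y => vh (y + 2 * T) - hat_jump (y + 2 * T)).
    by apply/funext => y; rewrite (is_hat_shift (y + 2 * T) hv) !addrK.
  apply: cvgB; last exact: (@continuous_at_translate hat_jump (2 * T) x (ch _)).
  by apply: (@continuous_at_translate vh (2 * T) x); apply: IH; nra.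
move=> x; have := @archi_boundP R (`|x| / T).
rewrite divr_ge0 ?(ltW T_gt0) // => /(_ isT).
rewrite ltr_pdivrMr // ltr_norml => /andP[x1 x2].
apply: (all (Num.bound (`|x| / T))).
have n0 : 0 <= (Num.bound (`|x| / T))%:R :> R by [].
by move: x1 x2 n0; move: (_%:R) => n *; nra.
Unshelve. all: by end_near. Qed.

End Hat.

(** * Travelling waves *)

Section Waves.
Context {R : realType}.
Implicit Types (f g F G : R -> R) (u : R -> R -> R).

(** Regularity of the profile of a travelling wave, by the same recursion as
    [Ck_strip]. *)
Fixpoint Ck (k : nat) (F : R -> R) : Prop :=
  if k is m.+1 then (forall x, derivable F x 1) /\ Ck m F^`() else continuous F.

Lemma derivable_continuous F : (forall x, derivable F x 1) -> continuous F.
Proof. by move=> dF x; apply/differentiable_continuous/derivable1_diffP. Qed.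

Lemma Ck_opp k F : Ck k F -> Ck k (fun x => - F x).
Proof.
elim: k F => [F cF x|k IH F [dF cF]]; first by apply: cvgN; exact: cF.
split=> [x|]; first exact: derivableN.
rewrite (_ : _^`() = fun x => - F^`() x); first exact: IH.
by apply/funext => x; rewrite derive1N.
Qed.

Variable T : R.
Hypothesis T_gt0 : 0 < T.

Lemma eq_C0_strip u1 u2 :
  (forall t x, 0 <= t <= T -> u1 t x = u2 t x) -> C0_strip T u1 -> C0_strip T u2.
Proof.
move=> u12; apply: subspace_eq_continuous => -[t x].
by rewrite inE /= in_itv /= => -[tT _]; exact: u12.
Qed.

Lemma eq_dt u1 u2 t x :
  (forall t x, 0 <= t <= T -> u1 t x = u2 t x) -> 0 <= t <= T ->
  dt T u1 t x = dt T u2 t x.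
Proof.
by move=> u12 tT; rewrite /dt (eq_derive_within tT (fun s sT => u12 s x sT)).2.
Qed.

Lemma eq_dx u1 u2 t x :
  (forall t x, 0 <= t <= T -> u1 t x = u2 t x) -> 0 <= t <= T ->
  dx u1 t x = dx u2 t x.
Proof.
by move=> u12 tT; rewrite /dx (_ : u1 t = u2 t) //; apply/funext => y; rewrite u12.
Qed.

(** An induced solution is a travelling wave for nonnegative times only, which is
    why regularity must be insensitive to values outside the strip. *)
Lemma eq_Ck_strip k u1 u2 :
  (forall t x, 0 <= t <= T -> u1 t x = u2 t x) ->
  Ck_strip T k u1 -> Ck_strip T k u2.
Proof.
elim: k u1 u2 => [|k IH] u1 u2 u12 /=; first exact: eq_C0_strip.
move=> [c0 du ct cx]; split.
- exact: eq_C0_strip c0.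
- move=> t x tT; have [dut dux] := du t x tT.
  have tT' : 0 <= t <= T by move: tT; rewrite in_itv.
  rewrite -(eq_derive_within tT' (fun s sT => u12 s x sT)).1; split=> //.
  by rewrite (_ : u2 t = u1 t) //; apply/funext => y; rewrite u12.
- by apply: IH ct => t x; exact: eq_dt.
- by apply: IH cx => t x; exact: eq_dx.
Qed.

Definition travelling F G (t x : R) : R := F (x + t) + G (x - t).

Lemma travelling_is_derive_t F G (f g t x : R) :
  is_derive (x + t) 1 F f -> is_derive (x - t) 1 G g ->
  is_derive t 1 (fun s => travelling F G s x) (f - g).
Proof.
move=> dF dG; have dF' : is_derive (x + 1 * t) 1 F f by rewrite mul1r.
have dG' : is_derive (x + -1 * t) 1 G g by rewrite mulN1r.
have := is_deriveD (is_derive_comp_affine dF') (is_derive_comp_affine dG').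
rewrite mul1r mulN1r (_ : _ + _ = fun s => travelling F G s x) //.
by apply/funext => s; rewrite -[LHS]/(F (x + 1 * s) + G (x + -1 * s)) mul1r mulN1r.
Qed.

Lemma travelling_is_derive_x F G (f g t x : R) :
  is_derive (x + t) 1 F f -> is_derive (x - t) 1 G g ->
  is_derive x 1 (travelling F G t) (f + g).
Proof.
move=> dF dG; have dF' : is_derive (t + 1 * x) 1 F f by rewrite mul1r addrC.
have dG' : is_derive (- t + 1 * x) 1 G g by rewrite mul1r addrC.
have := is_deriveD (is_derive_comp_affine dF') (is_derive_comp_affine dG').
rewrite !mul1r (_ : _ + _ = travelling F G t) //.
apply/funext => s; rewrite -[LHS]/(F (t + 1 * s) + G (- t + 1 * s)) !mul1r.
by rewrite ![_ + s]addrC.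
Qed.

Lemma dt_travelling F G t x : (forall x, derivable F x 1) ->
  (forall x, derivable G x 1) -> 0 <= t <= T ->
  derivable_within `[0, T] (fun s => travelling F G s x) t /\
  dt T (travelling F G) t x = travelling F^`() (fun y => - G^`() y) t x.
Proof.
move=> dF dG tT; apply: (is_derive_within T_gt0 tT).
exact: (travelling_is_derive_t (is_derive_derive1 (dF _)) (is_derive_derive1 (dG _))).
Qed.

Lemma dx_travelling F G t x : (forall x, derivable F x 1) ->
  (forall x, derivable G x 1) ->
  derivable (travelling F G t) x 1 /\
  dx (travelling F G) t x = travelling F^`() G^`() t x.
Proof.
move=> dF dG.
have d := travelling_is_derive_x (is_derive_derive1 (dF (x + t)))
  (is_derive_derive1 (dG (x - t))).
by split; [case: d|rewrite /dx (derive1_is_derive d)].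
Qed.

Lemma Ck_travelling k F G : Ck k F -> Ck k G -> Ck_strip T k (travelling F G).
Proof.
have c0 (F0 G0 : R -> R) : continuous F0 -> continuous G0 ->
    C0_strip T (travelling F0 G0).
  move=> cF cG; apply: continuous_subspaceT => p.
  apply: cvgD.
    apply: (@continuous_comp _ _ _ (fun p : R * R => p.2 + p.1) F0); last exact: cF.
    by apply: cvgD; [exact: cvg_snd|exact: cvg_fst].
  apply: (@continuous_comp _ _ _ (fun p : R * R => p.2 - p.1) G0); last exact: cG.
  by apply: cvgB; [exact: cvg_snd|exact: cvg_fst].
elim: k F G => [|k IH] F G; first exact: c0.
move=> [dF cF] [dG cG]; split.
- by apply: c0; exact: derivable_continuous.
- move=> t x; rewrite in_itv /= => tT; split; last by case: (dx_travelling t x dF dG).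
  by case: (dt_travelling x dF dG tT).
- apply: eq_Ck_strip (IH _ _ cF (Ck_opp cG)) => t x tT.
  by have [_ ->] := dt_travelling x dF dG tT.
- apply: eq_Ck_strip (IH _ _ cF cG) => t x tT.
  by have [_ ->] := dx_travelling t x dF dG.
Qed.

Lemma travelling_wave F G t x : Ck 2 F -> Ck 2 G -> 0 <= t <= T ->
  dt T (dt T (travelling F G)) t x = dx (dx (travelling F G)) t x.
Proof.
move=> [dF [dF' _]] [dG [dG' _]] tT.
have dNG' y : derivable (fun y => - G^`() y) y 1 by exact: derivableN.
rewrite (@eq_dt _ (travelling F^`() (fun y => - G^`() y))) //; last first.
  by move=> {tT}t {}x tT; case: (dt_travelling x dF dG tT).
rewrite (@eq_dx _ (travelling F^`() G^`())) //; last first.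
  by move=> {tT}t {}x _; case: (dx_travelling t x dF dG).
have [_ ->] := dt_travelling x dF' dNG' tT.
have [_ ->] := dx_travelling t x dF' dG'.
by rewrite /travelling derive1N // opprK.
Qed.

End Waves.

(** * Solutions induced by compatible functions *)

Section Induced.
Context {R : realType}.
Variables (T : R) (f0 fT : R -> R).
Hypothesis T_gt0 : 0 < T.
Hypothesis f0_smooth : smooth f0.
Hypothesis fT_smooth : smooth fT.

Let NTT : - T <= T. Proof. by rewrite ge0_cp ?ltW. Qed.

Let df0 n (x : R) : is_derive x 1 (f0^`(n)) (f0^`(n.+1) x).
Proof. exact: smooth_is_derive. Qed.

Let dfT n (x : R) : is_derive x 1 (fT^`(n)) (fT^`(n.+1) x).
Proof. exact: smooth_is_derive. Qed.

Lemma smooth_continuous (f : R -> R) n : smooth f -> continuous (f^`(n)).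
Proof. by move=> sf; exact: is_derive_continuous (smooth_is_derive sf n). Qed.

Lemma is_hat_endpoint (v vh : R -> R) : is_hat T f0 fT v vh ->
  vh T = v (- T) + c1 T f0 fT.
Proof.
move=> [hv hr]; have NT : - T < T by move: T_gt0; lra.
have := hr 0; rewrite !add0r (hv (- T)) ?lexx ?NT // => ->.
by rewrite /c1 !addrA.
Qed.

Lemma is_derive_shift_arg (f : R -> R) (c x d : R) :
  is_derive (x + c) 1 f d -> is_derive x 1 (fun y => f (y + c)) d.
Proof.
move=> df; have df' : is_derive (c + 1 * x) 1 f d by rewrite mul1r addrC.
have := is_derive_comp_affine df'; rewrite mul1r.
rewrite (_ : (fun y => _) = fun y => f (y + c)) //.
by apply/funext => y; rewrite mul1r addrC.
Qed.

(** The extension of the derivative [v'] is continuous, with data [f0'] and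
    [fT'] in place of [f0] and [fT]. Its primitive through [v (- T)] satisfies
    the defining relations of [hat v], hence is [hat v] by uniqueness. *)
Lemma hat_is_derive (v : R -> R) : C0_itv (- T) T v -> C1_compatible T f0 fT v ->
  exists2 d : R -> R, continuous d &
    forall x : R, is_derive x 1 (hat T f0 fT v) (d x).
Proof.
move=> cv [[dv cdv] vT dvT]; set v' := derive_within _ _ in cdv dvT.
pose d := hat T f0^`() fT^`() v'.
have hd : is_hat T f0^`() fT^`() v' d := hatP _ _ T_gt0 _.
have cd : continuous d.
  apply: (is_hat_continuous T_gt0 hd _ _ cdv dvT).
  - exact: (@smooth_continuous f0 2 f0_smooth).
  - exact: (@smooth_continuous fT 2 fT_smooth).
exists d => //; have [F dF] := primitive_exists cd.
pose V x := F x + (v (- T) - F (- T)).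
have dV (x : R) : is_derive x 1 V (d x).
  by have := is_deriveD (dF x) (is_derive_cst (v (- T) - F (- T)) x 1); rewrite addr0.
have cV := is_derive_continuous dV.
have Vv x : - T <= x <= T -> V x = v x.
  move=> /andP[Tx xT]; apply/eqP; rewrite -subr_eq0; apply/eqP.
  have -> : 0 = V (- T) - v (- T) by rewrite /V addrC subrKC addNr.
  apply: (@is_derive0_itv_eq R (- T) x (fun x => V x - v x) Tx).
    have cv' : C0_itv (- T) x v.
      apply: continuous_subspaceW cv => y /=; rewrite !in_itv /= => /andP[-> yx].
      exact: le_trans yx xT.
    by move=> y; apply: cvgB; [exact: continuous_subspaceT|exact: cv'].
  move=> y /andP[Ty yx].
  have yT : - T < y < T by rewrite Ty (lt_le_trans yx).
  have yT' : y \in `[- T, T]%R by rewrite in_itv /= ltW //= ltW // (lt_le_trans yx).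
  have d2 := derivable_within_itvoo yT (dv y yT').
  have := is_deriveB (dV y) d2; rewrite hd.1 ?subrr //.
  by rewrite (ltW Ty) (lt_le_trans yx).
rewrite (_ : hat T f0 fT v = V) //.
apply: (is_hat_unique T_gt0 (hatP f0 fT T_gt0 v)); split=> [x /andP[Tx xT]|x].
  by apply: Vv; rewrite Tx ltW.
pose E x := V (x + T) - V (x + - T) - (2 * fT^`() x - f0^`() (x + T) - f0^`() (x + - T)).
have dE (y : R) : is_derive y 1 E 0.
  have e1 := is_derive_shift_arg (dV (y + T)).
  have e2 := is_derive_shift_arg (dV (y + - T)).
  have e3 := is_derive_shift_arg (df0 1 (y + T)).
  have e4 := is_derive_shift_arg (df0 1 (y + - T)).
  have e5 := is_deriveZ 2 (dfT 1 y).
  have := is_deriveB (is_deriveB e1 e2) (is_deriveB (is_deriveB e5 e3) e4).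
  rewrite (hd.2 y); set z := (X in is_derive _ _ _ X) => D.
  suff <- : z = 0 by exact: D.
  rewrite /z /GRing.scale /=.
  move: (d _) => a; move: (fT^`()^`() y) (f0^`()^`() _) (f0^`()^`() _) => b c e.
  by ring.
have E0 : E 0 = 0.
  rewrite /E !add0r (Vv T) ?NTT ?lexx // (Vv (- T)) ?NTT ?lexx // vT /c1.
  by move: (v _) (fT^`() 0) (f0^`() T) (f0^`() (- T)) => *; ring.
have := is_derive_0_is_cst x 0 dE; rewrite E0 /E.
move: (V _) (V _) (fT^`() x) (f0^`() _) (f0^`() _) => *; lra.
Qed.

Lemma Ck_is_derive k (F f : R -> R) : (forall x : R, is_derive x 1 F (f x)) ->
  Ck k f -> Ck k.+1 F.
Proof.
move=> dF cf; split; first by move=> x; case: (dF x).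
by rewrite (_ : F^`() = f) //; apply/funext => x; exact: derive1_is_derive.
Qed.

(** With [V] a primitive of [hat v], the induced solution is
    [F (x + t) + G (x - t)] for [F = (f0 + V) / 2] and [G = (f0 - V) / 2]. At time
    [T] its derivative in [x] is [fT'] by the relation that defines [hat v], and
    its value at [x = 0] is [fT 0] by the condition on the integral of [v]. *)
Lemma induced_is_solution (v : R -> R) : C0_itv (- T) T v ->
  C1_compatible T f0 fT v -> int_itv (- T) T v = cA T f0 fT ->
  is_solution T f0 fT (induced_sol f0 (hat T f0 fT v)) /\
  input T (induced_sol f0 (hat T f0 fT v)) = hat T f0 fT v.
Proof.
move=> cv Cv iv; have [d cd dh] := hat_is_derive cv Cv.
set vh := hat T f0 fT v in dh *.
have hv : is_hat T f0 fT v vh := hatP _ _ T_gt0 _.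
have ch := is_derive_continuous dh; have [V dV] := primitive_exists ch.
have VT : V T - V (- T) = cA T f0 fT.
  rewrite -(int_itvE NTT ch dV) -iv; apply: eq_int_itv => x /andP[Tx].
  rewrite le_eqVlt => /predU1P[->|xT]; last by apply: hv.1; rewrite Tx.
  by rewrite (is_hat_endpoint hv); case: Cv.
pose F x := 2^-1 * (f0 x + V x); pose G x := 2^-1 * (f0 x - V x).
have comb s : Ck 2 (fun x => 2^-1 * (f0 x + s * V x)).
  have d0 (x : R) : is_derive x 1 (fun x => 2^-1 * (f0 x + s * V x))
                      (2^-1 * (f0^`(1) x + s * vh x)).
    exact: (is_deriveZ (2^-1 : R) (is_deriveD (df0 0 x) (is_deriveZ s (dV x)))).
  have d1 (x : R) : is_derive x 1 (fun x => 2^-1 * (f0^`(1) x + s * vh x))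
                      (2^-1 * (f0^`(2) x + s * d x)).
    exact: (is_deriveZ (2^-1 : R) (is_deriveD (df0 1 x) (is_deriveZ s (dh x)))).
  apply: (Ck_is_derive d0); apply: (Ck_is_derive d1) => x.
  apply: cvgM; first exact: cvg_cst.
  apply: cvgD; first exact: (@smooth_continuous f0 2 f0_smooth).
  by apply: cvgM; [exact: cvg_cst|exact: cd].
have cF : Ck 2 F.
  have -> : F = fun x => 2^-1 * (f0 x + 1 * V x).
    by apply/funext => x; rewrite mul1r.
  exact: comb.
have cG : Ck 2 G.
  have -> : G = fun x => 2^-1 * (f0 x + -1 * V x).
    by apply/funext => x; rewrite mulN1r.
  exact: comb.
set u := induced_sol f0 vh.
have uE t x : 0 <= t <= T -> travelling F G t x = u t x.
  move=> /andP[t0 _]; rewrite /u /induced_sol.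
  rewrite (int_itvE (_ : x - t <= x + t) ch dV); last by rewrite lerD2l ge0_cp.
  by rewrite /travelling /F /G; field.
have T0 : (0 : R) <= (0 : R) <= T by rewrite lexx /= ltW.
have F' x : F^`() x = 2^-1 * (f0^`() x + vh x).
  exact: derive1_is_derive (is_deriveZ (2^-1 : R) (is_deriveD (df0 0 x) (dV x))).
have G' x : G^`() x = 2^-1 * (f0^`() x - vh x).
  exact: derive1_is_derive (is_deriveZ (2^-1 : R) (is_deriveB (df0 0 x) (dV x))).
split; last first.
  apply/funext => x; rewrite /input -(eq_dt x uE T0).
  have [_ ->] := dt_travelling T_gt0 x cF.1 cG.1 T0.
  rewrite /travelling addr0 subr0 F' G'.
  by move: (f0^`() x) => a; field.
split.
- exact: eq_Ck_strip uE (Ck_travelling T_gt0 cF cG).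
- move=> t x; rewrite in_itv /= => tT.
  have uEt s y : 0 <= s <= T -> dt T (travelling F G) s y = dt T u s y.
    exact: eq_dt.
  have uEx s y : 0 <= s <= T -> dx (travelling F G) s y = dx u s y.
    exact: eq_dx.
  rewrite -(eq_dt x uEt tT) -(eq_dx x uEx tT) (travelling_wave T_gt0) ?subrr //.
- by move=> x; rewrite -uE // /travelling /F /G addr0 subr0; field.
- move=> x; have TT : 0 <= T <= T by rewrite ltW /=.
  rewrite -uE //.
  pose E x := travelling F G T x - fT x.
  have dE (y : R) : is_derive y 1 E 0.
    have e1 := travelling_is_derive_x (is_derive_derive1 (cF.1 (y + T)))
      (is_derive_derive1 (cG.1 (y - T))).
    have := is_deriveB e1 (dfT 0 y); set z := (X in is_derive _ _ _ X) => D.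
    suff <- : z = 0 by exact: D.
    rewrite /z F' G' hv.2 derive1n1.
    move: (vh (y - T)) (fT^`() y) (f0^`() (y + T)) (f0^`() (y - T)) => *.
    by field.
  have := is_derive_0_is_cst x 0 dE; rewrite /E /travelling !add0r => e.
  apply/eqP; rewrite -subr_eq0; apply/eqP; rewrite e /F /G.
  have -> : V T = V (- T) + cA T f0 fT by rewrite -VT addrC subrK.
  by rewrite /cA; field.
Qed.

End Induced.

(** * Sums of distances and sorted values *)

Section Sorted.
Context {R : realType}.
Implicit Types (s : seq R) (y z : R) (j : nat).

(** A term of the first sum is twice the positive part of [y - a], a term of the
    second one twice the positive part of [a - y]. *)
Definition excess s j y : R :=
  \sum_(a <- take j s) (`|y - a| + (y - a)) +
  \sum_(a <- drop j s) (`|y - a| - (y - a)).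

Lemma normD_ge0 z : 0 <= `|z| + z.
Proof. by have := ler_norm (- z); rewrite normrN; lra. Qed.

Lemma normB_ge0 z : 0 <= `|z| - z.
Proof. by have := ler_norm z; lra. Qed.

Lemma excess_ge0 s j y : 0 <= excess s j y.
Proof.
apply: addr_ge0; apply: sumr_ge0 => a _; [exact: normD_ge0|exact: normB_ge0].
Qed.

(** Adding [y - a] for the first [j] values and subtracting it for the others
    turns the distances into the excess, up to a linear function of [y]. *)
Lemma sum_dist_excess s j y z :
  \sum_(a <- s) `|y - a| - \sum_(a <- s) `|z - a| -
  ((size (drop j s))%:R - (size (take j s))%:R) * (y - z) =
  excess s j y - excess s j z.
Proof.
rewrite -[in LHS](cat_take_drop j s) !big_cat /= /excess cat_take_drop.
move: (take j s) (drop j s) => p q.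
have cst (r : seq R) x : \sum_(a <- r) x = (size r)%:R * x.
  by rewrite big_const_seq count_predT iter_addr_0 mulr_natl.
rewrite !big_split /= !sumrN !sumrB !cst.
by ring.
Qed.

Lemma excess_eq0 s j y :
  (excess s j y == 0) = all (>= y) (take j s) && all (<= y) (drop j s).
Proof.
rewrite /excess paddr_eq0; last 2 first.
- by apply: sumr_ge0 => a _; exact: normD_ge0.
- by apply: sumr_ge0 => a _; exact: normB_ge0.
congr (_ && _).
- rewrite psumr_eq0; last by move=> a _; exact: normD_ge0.
  apply: eq_all => a /=; apply/idP/idP => [/eqP|ya].
    by have := normr_ge0 (y - a); lra.
  by rewrite ler0_norm ?subr_le0 // addNr.
- rewrite psumr_eq0; last by move=> a _; exact: normB_ge0.
  apply: eq_all => a /=; apply/idP/idP => [/eqP|ya].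
    by have := normr_ge0 (y - a); lra.
  by rewrite ger0_norm ?subr_ge0 // subrr.
Qed.

(** The excess vanishes when the first [j] values are at least [y] and the others
    at most [y]; for a decreasing sequence the two values next to the cut decide
    this. The defaults make the conditions beyond either end void. *)
Lemma excess_eq0_nth s j y : sorted >=%R s -> (j <= size s)%N ->
  (nth -oo [seq a%:E | a <- s] j <= y%:E <= nth -oo (+oo :: [seq a%:E | a <- s]) j)%E
  = (excess s j y == 0).
Proof.
move=> ss js; rewrite excess_eq0 andbC.
have mono i k : (k < size s)%N -> (i <= k)%N -> nth 0 s k <= nth 0 s i.
  move=> ks ik; apply: (sorted_leq_nth ge_trans ge_refl 0 ss) => //.
  exact: leq_ltn_trans ks.
congr (_ && _).
- case: j js => [_|i js] /=; first by rewrite leey take0.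
  rewrite (nth_map 0) // lee_fin; apply/idP/(all_nthP 0) => [yi k|H].
    rewrite size_takel // => ki; rewrite nth_take //= (le_trans yi) //.
    exact: mono.
  by have := H i; rewrite size_takel // nth_take //=; apply.
- have [sj|sj] := leqP (size s) j.
    by rewrite nth_default ?size_map // leNye drop_oversize.
  rewrite (nth_map 0) // lee_fin; apply/idP/(all_nthP 0) => [yj k|H].
    rewrite size_drop nth_drop ltn_subRL => ki /=; apply: le_trans yj.
    by apply: mono => //; exact: leq_addr.
  by have := H 0%N; rewrite size_drop nth_drop addn0 subn_gt0; exact.
Qed.

Lemma sorted_count_nth s i y : sorted >=%R s -> (i < size s)%N ->
  (y <= nth 0 s i) = (i < count (>= y) s)%N.
Proof.
elim: s i => [//|a s IH] i /= ss.
have /allP sa := order_path_min ge_trans ss.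
have [ya|ay] := leP y a.
  case: i => [_|i]; first by rewrite ya.
  by rewrite ltnS add1n ltnS; apply: IH; exact: path_sorted ss.
have -> : count (>= y) s = 0%N.
  apply/eqP; rewrite -leqn0 leqNgt -has_count; apply/hasPn => b /sa /= ba.
  by rewrite -ltNge (le_lt_trans ba).
case: i => [_|i]; first by rewrite ltNge in ay; rewrite (negbTE ay).
rewrite ltnS => is_; apply/negbTE; rewrite -ltNge /=; apply: le_lt_trans ay.
exact/sa/mem_nth.
Qed.

(** The [i]-th largest value is at least [y] when more than [i] of the values
    are, which is a condition stable under small perturbation of the values. *)
Lemma sort_nth_le (p q : nat -> R) (r : seq nat) (e : R) (i : nat) :
  (forall k, k \in r -> p k - e <= q k) -> (i < size r)%N ->
  nth 0 (sort >=%R [seq p k | k <- r]) i - e <=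
  nth 0 (sort >=%R [seq q k | k <- r]) i.
Proof.
move=> pq ir.
have ss (g : nat -> R) : sorted >=%R (sort >=%R [seq g k | k <- r]).
  exact/sort_sorted/ge_total.
have sz (g : nat -> R) : (i < size (sort >=%R [seq g k | k <- r]))%N.
  by rewrite size_sort size_map.
have cnt (g : nat -> R) y : count (>= y) (sort >=%R [seq g k | k <- r]) =
    count (fun k => y <= g k) r.
  have /permP -> : perm_eq (sort >=%R [seq g k | k <- r]) [seq g k | k <- r].
    by rewrite perm_sort.
  by rewrite count_map.
rewrite sorted_count_nth // cnt.
set b := nth 0 (sort >=%R [seq p k | k <- r]) i.
have : b <= b by []; rewrite {2}/b sorted_count_nth // cnt => /leq_trans; apply.
rewrite (@eq_in_count _ _ (fun k => (b <= p k) && (b - e <= q k))); last first.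
  move=> k kr /=; case: leP => //= bk; apply/esym.
  by apply: le_trans (pq k kr); rewrite lerD2r.
by apply: sub_count => k /andP[].
Qed.

Lemma sort_nth_continuous (F : nat -> R -> R) (r : seq nat) (i : nat) :
  (forall k, continuous (F k)) -> (i < size r)%N ->
  continuous (fun x => nth 0 (sort >=%R [seq F k x | k <- r]) i).
Proof.
move=> cF ir x; apply/cvgrPdist_le => e e0.
have : \forall y \near x, forall k, k \in r -> `|F k x - F k y| <= e.
  elim: {ir}r => [|k r IH]; first by near=> y => k; rewrite in_nil.
  have /cvgrPdist_le/(_ e e0) Fk := cF k x.
  near=> y => l; rewrite inE => /predU1P[->|].
    by near: y.
  by move: l; near: y.
apply: filterS => y H; rewrite ler_distl; apply/andP; split.
  by apply: (@sort_nth_le (F^~ y) (F^~ x)) => // k /H; rewrite ler_norml; lra.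
rewrite -lerBlDr.
by apply: (@sort_nth_le (F^~ x) (F^~ y)) => // k /H; rewrite ler_norml; lra.
Unshelve. all: by end_near. Qed.

End Sorted.

(** * Values of the extension on translated intervals *)

Section Pieces.
Context {R : realType}.
Variables (T : R) (f0 fT : R -> R).
Hypothesis T_gt0 : 0 < T.

Lemma t_right0 x : t_right T f0 fT 0 x = 0.
Proof.
by rewrite /t_right !big_geq // !mulr0 mul0r !addr0 subr0 subrr.
Qed.

Lemma t_rightS k x :
  t_right T f0 fT k.+1 x = t_right T f0 fT k x - hat_jump T f0 fT (x + 2 * k.+1%:R * T).
Proof.
rewrite /t_right !big_nat_recl // /hat_jump.
have E n : 2 * k.+1%:R - 2 * n.+1%:R = 2 * k%:R - 2 * n%:R :> R.
  by rewrite -(natr1 k) -(natr1 n); ring.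
under eq_bigr do rewrite E.
under [in X in _ + _ - X - _ = _]eq_bigr do rewrite E.
rewrite mulr0 subr0.
rewrite (_ : x + 2 * k.+1%:R * T - T = x + (2 * k.+1%:R - 1) * T); last by ring.
rewrite (_ : x + 2 * k.+1%:R * T - 2 * T = x + 2 * k%:R * T); last first.
  by rewrite -(natr1 k); ring.
move: (\sum_(0 <= i < k) _) (\sum_(0 <= i < k) _) => s1 s2.
by move: (f0^`() x) (f0^`() _) (f0^`() _) (fT^`() _) => *; ring.
Qed.

Lemma t_leftS k x :
  t_left T f0 fT k.+1 x = t_left T f0 fT k x + hat_jump T f0 fT (x - 2 * k%:R * T).
Proof.
rewrite /t_left !big_nat_recl // /hat_jump.
have E1 n : 2 * n.+1%:R + 1 - 2 * k.+1%:R = 2 * n%:R + 1 - 2 * k%:R :> R.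
  by rewrite -(natr1 k) -(natr1 n); ring.
have E2 n : n.+1%:R + 1 - k.+1%:R = n%:R + 1 - k%:R :> R.
  by rewrite -(natr1 k) -(natr1 n); ring.
under eq_bigr do rewrite E1.
under [in X in _ + _ - X - _ = _]eq_bigr do rewrite E2.
rewrite mulr0 !add0r.
rewrite (_ : x - 2 * k%:R * T - T = x + (1 - 2 * k.+1%:R) * T); last first.
  by rewrite -(natr1 k); ring.
rewrite (_ : x - 2 * k%:R * T - 2 * T = x - 2 * k.+1%:R * T); last first.
  by rewrite -(natr1 k); ring.
rewrite (_ : x + 2 * (1 - k.+1%:R) * T = x - 2 * k%:R * T); last first.
  by rewrite -(natr1 k); ring.
move: (\sum_(0 <= i < k) _) (\sum_(0 <= i < k) _) => s1 s2.
by move: (f0^`() x) (f0^`() _) (f0^`() _) (fT^`() _) => *; ring.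
Qed.

(** Each step of [2 T] to the right adds one increment of the extension, and
    [- t_right k] is the sum of the first [k] of them. *)
Lemma hat_right v vh k x : is_hat T f0 fT v vh ->
  vh (x + 2 * k%:R * T) = vh x - t_right T f0 fT k x.
Proof.
move=> hv; elim: k => [|k IH]; first by rewrite t_right0 mulr0 mul0r addr0 subr0.
rewrite (is_hat_shift _ hv) t_rightS.
rewrite (_ : x + 2 * k.+1%:R * T - 2 * T = x + 2 * k%:R * T); last first.
  by rewrite -(natr1 k); ring.
by rewrite IH; ring.
Qed.

Lemma hat_left v vh k x : is_hat T f0 fT v vh ->
  vh (x - 2 * k%:R * T) = vh x - t_left T f0 fT k x.
Proof.
move=> hv; elim: k => [|k IH].
  by rewrite /t_left !big_geq // !mulr0 mul0r !subr0 !addr0 !subrr subr0.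
rewrite t_leftS opprD addrA -IH (is_hat_shift (x - 2 * k%:R * T) hv) addrK.
by congr (vh _); rewrite -(natr1 k); ring.
Qed.

End Pieces.

(** * The functional as an integral over one period *)

Section PieceIntegrals.
Context {R : realType}.
Implicit Types (f g : R -> R) (a b c : R).
Local Notation mu := (@lebesgue_measure R).

Lemma int_itv_shift a b c f : a <= b -> continuous f ->
  int_itv (a + c) (b + c) f = int_itv a b (fun x => f (x + c)).
Proof.
move=> ab cf; have [F dF] := primitive_exists cf.
have cfc : continuous (fun x => f (x + c)).
  by move=> x; exact: (@continuous_at_translate _ f c x (cf _)).
rewrite (int_itvE ab cfc (fun x => is_derive_shift_arg (dF (x + c)))).
by rewrite (int_itvE _ cf dF) // lerD2r.
Qed.

Lemma integral_norm_continuous a b f : continuous f ->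
  (\int[mu]_(x in `[a, b]) `|f x|%:E)%E = (int_itv a b (fun x => `|f x|))%:E.
Proof.
move=> cf; rewrite /int_itv /Rintegral fineK //.
have cn : continuous (fun x => `|f x|) by move=> x; exact: (cvg_norm (cf x)).
by apply: integrable_fin_num => //; exact: integrable_itv cn.
Qed.

(** Measurability is part of the statement because the extension need not be
    continuous where two pieces meet. *)
Definition norm_integral_on (h : R -> R) a b (s : R) :=
  measurable_fun `[a, b[ h /\ (\int[mu]_(x in `[a, b[) `|h x|%:E)%E = s%:E.

Lemma norm_integral_on_continuous h g a b : continuous g ->
  (forall x, a <= x < b -> h x = g x) ->
  norm_integral_on h a b (int_itv a b (fun x => `|g x|)).
Proof.
move=> cg hg; have mg : measurable_fun `[a, b[ g.
  by apply: subspace_continuous_measurable_fun => //; exact: continuous_subspaceT.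
split.
  by apply: eq_measurable_fun mg => x; rewrite inE /= in_itv /= => /hg.
rewrite -integral_norm_continuous // -integral_itv_bndo_bndc.
  by apply: eq_integral => x; rewrite inE /= in_itv /= => /hg ->.
by apply/measurable_EFinP; apply: measurableT_comp.
Qed.

Lemma norm_integral_on_cat h a b c s1 s2 : a <= b -> b <= c ->
  norm_integral_on h a b s1 -> norm_integral_on h b c s2 ->
  norm_integral_on h a c (s1 + s2).
Proof.
move=> ab bc [m1 i1] [m2 i2]; rewrite /norm_integral_on.
rewrite (@itv_bndbnd_setU _ _ (BLeft a) (BLeft b) (BLeft c)) ?bnd_simp //.
have m : measurable_fun (`[a, b[ `|` `[b, c[) h by apply/measurable_funU.
have dis : [disjoint `[a, b[%classic & `[b, c[%classic].
  apply/disj_setPS => x [] /=; rewrite !in_itv /= => /andP[_ xb] /andP[bx _].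
  by move: (lt_le_trans xb bx); rewrite ltxx.
have mn : measurable_fun (`[a, b[ `|` `[b, c[) (fun x => `|h x|%:E).
  by apply/measurable_EFinP; apply: measurableT_comp.
by split=> //; rewrite ge0_integral_setU // ?i1 ?i2 // => x _; rewrite lee_fin.
Qed.

End PieceIntegrals.

Section ContinuousSums.
Context {R : realType}.

Lemma continuous_sum (I : Type) (r : seq I) (F : I -> R -> R) :
  (forall i, continuous (F i)) -> continuous (fun x => \sum_(i <- r) F i x).
Proof.
move=> cF x; elim: r => [|i r IH].
  rewrite (_ : (fun _ => _) = fun=> 0); first exact: cvg_cst.
  by apply/funext => y; rewrite big_nil.
rewrite (_ : (fun _ => _) = fun y => F i y + \sum_(j <- r) F j y).
  by apply: cvgD; [exact: cF|exact: IH].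
by apply/funext => y; rewrite big_cons.
Qed.

Lemma int_itv_sum (I : Type) (r : seq I) (F : I -> R -> R) a b :
  (forall i, continuous (F i)) ->
  int_itv a b (fun x => \sum_(i <- r) F i x) = \sum_(i <- r) int_itv a b (F i).
Proof.
move=> cF; elim: r => [|i r IH].
  rewrite big_nil /int_itv (_ : (fun _ => _) = fun=> 0).
    by rewrite Rintegral_cst // mul0r.
  by apply/funext => y; rewrite big_nil.
rewrite (_ : (fun _ => _) = fun y => F i y + \sum_(j <- r) F j y).
  by rewrite int_itvD ?big_cons ?IH //; exact: continuous_sum.
by apply/funext => y; rewrite big_cons.
Qed.

End ContinuousSums.

Section Functional.
Context {R : realType}.
Variables (T : R) (f0 fT : R -> R).
Hypothesis T_gt0 : 0 < T.
Hypothesis f0_smooth : smooth f0.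
Hypothesis fT_smooth : smooth fT.

Let NTT : - T <= T. Proof. by rewrite ge0_cp ?ltW. Qed.

Let cjump : continuous (hat_jump T f0 fT).
Proof.
exact: continuous_hat_jump (@smooth_continuous _ f0 1 f0_smooth)
  (@smooth_continuous _ fT 1 fT_smooth).
Qed.

Lemma continuous_t_right k : continuous (t_right T f0 fT k).
Proof.
elim: k => [|k IH].
  rewrite (_ : t_right T f0 fT 0 = cst 0); first exact: cst_continuous.
  by apply/funext => x; rewrite t_right0.
rewrite (_ : t_right T f0 fT k.+1 = fun x => t_right T f0 fT k x
    - hat_jump T f0 fT (x + 2 * k.+1%:R * T)); last first.
  by apply/funext => x; rewrite t_rightS.
move=> x; apply: cvgB; first exact: IH.
exact: (@continuous_at_translate _ _ (2 * k.+1%:R * T) x (@cjump _)).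
Qed.

Lemma continuous_t_left k : continuous (t_left T f0 fT k).
Proof.
elim: k => [|k IH].
  rewrite (_ : t_left T f0 fT 0 = cst 0); first exact: cst_continuous.
  apply/funext => x; rewrite /t_left !big_geq // !mulr0 mul0r.
  by rewrite !subr0 !addr0 !subrr.
rewrite (_ : t_left T f0 fT k.+1 = fun x => t_left T f0 fT k x
    + hat_jump T f0 fT (x - 2 * k%:R * T)); last first.
  by apply/funext => x; rewrite t_leftS.
move=> x; apply: cvgD; first exact: IH.
exact: (@continuous_at_translate _ _ (- (2 * k%:R * T)) x (@cjump _)).
Qed.

Variables K1 K2 : nat.

Lemma continuous_t_fun i : continuous (t_fun T f0 fT K2 i).
Proof.
rewrite /t_fun; case: (i <= 1)%N; first exact: cst_continuous.
by case: (i <= K2.+1)%N; [exact: continuous_t_right|exact: continuous_t_left].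
Qed.

Definition indices := iota 1 (nb_pieces K1 K2).

Definition dist_sum (v : R -> R) (x : R) : R :=
  \sum_(i <- indices) `|v x - t_fun T f0 fT K2 i x|.

Lemma continuous_norm_sub (f g : R -> R) : continuous f -> continuous g ->
  continuous (fun x => `|f x - g x|).
Proof.
move=> cf cg x; apply: (@continuous_comp _ _ _ (fun x => f x - g x) Num.norm).
  by apply: cvgB; [exact: cf|exact: cg].
exact: norm_continuous.
Qed.

Lemma continuous_dist_sum v : continuous v -> continuous (dist_sum v).
Proof.
move=> cv; apply: continuous_sum => i; apply: continuous_norm_sub => //.
exact: continuous_t_fun.
Qed.

Lemma sum_indices (F : nat -> R) :
  \sum_(i <- indices) F i =
  \sum_(0 <= k < K2.+1) F k.+1 + \sum_(0 <= k < K1) F (k.+1 + K2.+1)%N.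
Proof.
rewrite /indices /nb_pieces (_ : (K1 + K2 + 1)%N = (K2.+1 + K1)%N); last by lia.
have -> : iota 1 (K2.+1 + K1) = index_iota 1 K2.+2 ++ index_iota (0 + K2.+2) (K1 + K2.+2).
  by rewrite iotaD /index_iota addnK subSS subn0.
rewrite big_cat /= big_add1 big_addn addnK; congr (_ + _).
by apply: eq_bigr => k _; congr F; lia.
Qed.

Lemma norm_integral_on_hat (v vh : R -> R) : continuous v -> is_hat T f0 fT v vh ->
  norm_integral_on vh (- ((2 * K1%:R + 1) * T)) ((2 * K2%:R + 1) * T)
    (int_itv (- T) T (dist_sum v)).
Proof.
move=> cv hv.
rewrite /dist_sum int_itv_sum; last first.
  by move=> i; apply: continuous_norm_sub => //; exact: continuous_t_fun.
rewrite sum_indices.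
have [T0 NTlt] : 0 <= T /\ - T < T by rewrite ltW //; split => //; move: T_gt0; lra.
(* One piece: on [- T + k, T + k) the extension is a translate of [v - g]. *)
have shift k (g : R -> R) a b : continuous g -> a = - T + k -> b = T + k ->
    (forall x, - T <= x < T -> vh (x + k) = v x - g x) ->
    norm_integral_on vh a b (int_itv (- T) T (fun x => `|v x - g x|)).
  move=> cg -> -> H.
  have cG : continuous (fun x => v x - g x).
    by move=> x; apply: cvgB; [exact: cv|exact: cg].
  have cGk : continuous (fun y => v (y - k) - g (y - k)).
    by move=> x; exact: (@continuous_at_translate _ _ (- k) x (cG _)).
  have cN : continuous (fun y => `|v (y - k) - g (y - k)|).
    by move=> x; exact: (cvg_norm (cGk x)).
  have := @norm_integral_on_continuous _ vh _ (- T + k) (T + k) cGk.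
  rewrite int_itv_shift //.
  rewrite (_ : (fun x => _) = fun x => `|v x - g x|); last first.
    by apply/funext => x; rewrite addrK.
  by apply=> x xT; rewrite -H ?subrK //; lra.
have right n : norm_integral_on vh (- T) ((2 * n%:R + 1) * T)
    (\sum_(0 <= k < n.+1) int_itv (- T) T (fun x => `|v x - t_right T f0 fT k x|)).
  elim: n => [|n IH].
    rewrite big_nat1; apply: (shift 0).
    - exact: continuous_t_right.
    - by rewrite addr0.
    - by rewrite mulr0 add0r mul1r addr0.
    - by move=> x xT; rewrite addr0 t_right0 subr0 hv.1.
  have n0 : 0 <= n%:R :> R by [].
  have nT : 0 <= n%:R * T by rewrite mulr_ge0.
  rewrite big_nat_recr //=; apply: norm_integral_on_cat IH _.
  - by lra.
  - by rewrite -(natr1 n); lra.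
  apply: (shift (2 * n.+1%:R * T)).
  - exact: continuous_t_right.
  - by rewrite -(natr1 n); ring.
  - by ring.
  - by move=> x xT; rewrite (hat_right _ _ hv) hv.1.
have left m b s : - T <= b -> norm_integral_on vh (- T) b s ->
    norm_integral_on vh (- ((2 * m%:R + 1) * T)) b
    (s + \sum_(0 <= k < m) int_itv (- T) T (fun x => `|v x - t_left T f0 fT k.+1 x|)).
  move=> bT H; elim: m => [|m IH].
    by rewrite big_geq // addr0 mulr0 add0r mul1r.
  have m0 : 0 <= m%:R :> R by [].
  have mT : 0 <= m%:R * T by rewrite mulr_ge0.
  rewrite big_nat_recr //= addrA [X in norm_integral_on _ _ _ X]addrC.
  apply: norm_integral_on_cat IH.
  - by rewrite -(natr1 m); lra.
  - by lra.
  apply: (shift (- (2 * m.+1%:R * T))).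
  - exact: continuous_t_left.
  - by ring.
  - by rewrite -(natr1 m); ring.
  - by move=> x xT; rewrite (hat_left _ _ hv) hv.1.
have := left K1 _ _ _ (right K2).
have K20 : 0 <= K2%:R * T by rewrite mulr_ge0.
have -> : - T <= (2 * K2%:R + 1) * T by lra.
move=> /(_ isT); congr norm_integral_on; congr (_ + _).
  apply: eq_big_nat => k /andP[_ kK]; apply: eq_int_itv => x _; rewrite /t_fun.
  by case: k kK => [|k] kK /=; rewrite ?t_right0 // !ltnS in kK *; rewrite kK.
apply: eq_big_nat => k _; apply: eq_int_itv => x _; rewrite /t_fun.
rewrite addnK (_ : (k.+1 + K2.+1 <= 1)%N = false); last by lia.
by rewrite (_ : (k.+1 + K2.+1 <= K2.+1)%N = false) //; lia.
Qed.

(** The interval on which the norm is taken consists of translates of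
    [[- T, T]]. Translating a piece back turns [hat v] into one of the [v - t_i]. *)
Lemma J1E (v : R -> R) : C0_itv (- T) T v ->
  J1 T f0 fT K1 K2 v = (int_itv (- T) T (dist_sum (clamp (- T) T v)))%:E.
Proof.
move=> cv; have cc := clamp_continuous NTT cv.
have hv : is_hat T f0 fT (clamp (- T) T v) (hat T f0 fT v).
  have [h1 h2] := hatP f0 fT T_gt0 v; split=> // x /andP[Tx xT].
  by rewrite clampE ?Tx ?ltW // h1 // Tx.
have [m i] := norm_integral_on_hat cc hv.
rewrite /J1 /input_norm L1normE -i -integral_itv_bndo_bndc //.
by apply/measurable_EFinP; apply: measurableT_comp.
Qed.

End Functional.

(** * Approximation with prescribed boundary differences *)

Section Approximation.
Context {R : realType}.
Variable T : R.
Hypothesis T_gt0 : 0 < T.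

Let NTT : - T <= T. Proof. by rewrite ge0_cp ?ltW. Qed.

(** The means [(V (x + d) - V x) / d] of [v] over short intervals are C^1; by
    compactness they are uniformly close to [v]. *)
Lemma C1_uniform_approx (v : R -> R) (e : R) : continuous v -> 0 < e ->
  exists m m' : R -> R, [/\ forall x : R, is_derive x 1 m (m' x), continuous m'
    & forall x, - T <= x <= T -> `|m x - v x| <= e].
Proof.
move=> cv e0; have [V dV] := primitive_exists cv.
have cov : \forall d \near 0^'+, forall x, `[- T, T]%classic x ->
    `|(V (x + d) - V x) / d - v x| <= e.
  have /compact_near_coveringP cov := @segment_compact R (- T) T.
  apply: cov => x _; have e2 : 0 < e / 2 by rewrite divr_gt0.
  have := cv x => /cvgrPdist_le/(_ _ e2)/nbhs_ballP[r /= r0 H].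
  near=> z d => /=.
  have d0 : 0 < d by near: d; exact: nbhs_right_gt.
  have dr : d < r / 2 by near: d; apply: nbhs_right_lt; rewrite divr_gt0.
  have zr : `|x - z| < r / 2.
    by near: z; apply/nbhs_ballP; exists (r / 2) => //=; rewrite divr_gt0.
  have [y /andP[zy yd] E] := @MVT_is_derive _ V v z (z + d)
    ltac:(by rewrite ltrDl) (fun y _ => dV y).
  rewrite E addrAC subrr add0r mulfK ?gt_eqF //.
  have vy : `|v x - v y| <= e / 2.
    by apply: H; move: zr; rewrite /ball /= !ltr_norml; lra.
  have vz : `|v x - v z| <= e / 2.
    by apply: H; move: zr; rewrite /ball /= !ltr_norml; lra.
  by move: vy vz; rewrite !ler_norml; lra.
near (0 : R)^'+ => d; have d0 : 0 < d by near: d; exact: nbhs_right_gt.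
have Hd x : - T <= x <= T -> `|(V (x + d) - V x) / d - v x| <= e.
  by move: x; near: d.
exists (fun x => d^-1 * (V (x + d) - V x)), (fun x => d^-1 * (v (x + d) - v x)).
split.
- move=> x.
  exact: (is_deriveZ d^-1 (is_deriveB (is_derive_shift_arg (dV (x + d))) (dV x))).
- move=> x; apply: cvgM; first exact: cvg_cst.
  by apply: cvgB; [exact: (@continuous_at_translate _ v d x (cv _))|exact: cv].
- by move=> x /Hd; rewrite mulrC.
Unshelve. all: by end_near. Qed.

Lemma power_is_derive (c : R) n (x : R) :
  is_derive x 1 (fun y => (c * y) ^+ n.+1) (c * (n.+1%:R * (c * x) ^+ n)).
Proof.
have d1 : is_derive (0 + c * x) 1 (fun y : R => y ^+ n.+1) (n.+1%:R * (c * x) ^+ n).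
  rewrite add0r.
  have := is_deriveX n.+1 (is_derive_id (c * x) (1 : R)).
  by rewrite exprfctE [_ *: _]mulr1.
have := is_derive_comp_affine d1.
rewrite (_ : (fun y => (0 + c * y) ^+ n.+1) = fun y => (c * y) ^+ n.+1) //.
by apply/funext => y; rewrite add0r.
Qed.

Lemma power_continuous (c : R) n : continuous (fun y : R => (c * y) ^+ n).
Proof.
case: n => [|n]; last exact: is_derive_continuous (power_is_derive c n).
by move=> x; exact: cvg_cst.
Qed.

(** Powers of [x / T] of high degree have small integral norm; an odd one
    adjusts the difference of the boundary values and an even one, whose
    derivative is odd, the difference of the boundary slopes. *)
Lemma boundary_corrector (a b e : R) : 0 < e ->
  exists q q' : R -> R, [/\ forall x : R, is_derive x 1 q (q' x), continuous q',
    q T - q (- T) = a, q' T - q' (- T) = b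
    & int_itv (- T) T (fun x => `|q x|) <= e].
Proof.
move=> e0; pose c := T^-1; pose C : R := `|a| + `|b| * T.
have T0 : 0 <= T by exact: ltW.
have C0 : 0 <= C by rewrite addr_ge0 // mulr_ge0.
have cT : c * T = 1 by rewrite mulVf // gt_eqF.
have [k kP] : exists k : nat, C * (2 * T) < e * k%:R.
  exists (Num.bound (C * (2 * T) / e)).
  rewrite [e * _]mulrC -ltr_pdivrMr //; apply: archi_boundP.
  by rewrite divr_ge0 ?mulr_ge0 // ltW.
pose p := k.*2.+1.
have op : odd p by rewrite /p /= odd_double.
have sgn (n : nat) : (c * - T) ^+ n = (-1) ^+ n by rewrite mulrN cT.
have sgn1 (n : nat) : (c * T) ^+ n = 1 by rewrite cT expr1n.
have s0 : (-1) ^+ p = -1 :> R by rewrite -signr_odd op.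
have s1 : (-1) ^+ p.+1 = 1 :> R by rewrite exprS s0 mulrNN mulr1.
have s2 : (-1) ^+ p.+2 = -1 :> R by rewrite exprS s1 mulr1.
(* [p + 2] is odd and [p + 1] even, so each term adjusts one of the two
   differences and does not affect the other. *)
pose a' := a / 2; pose b' := b * T / (2 * p.+1%:R).
have p0 : 0 < p.+1%:R :> R by [].
pose q x := a' * (c * x) ^+ p.+2 + b' * (c * x) ^+ p.+1.
pose q' x := a' * (c * (p.+2%:R * (c * x) ^+ p.+1)) + b' * (c * (p.+1%:R * (c * x) ^+ p)).
have cpow n := @power_continuous c n.
exists q, q'; split.
- move=> x; exact: (is_deriveD (is_deriveZ a' (power_is_derive c p.+1 x))
    (is_deriveZ b' (power_is_derive c p x))).
- move=> x; apply: cvgD; (apply: cvgM; first exact: cvg_cst);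
    (apply: cvgM; first exact: cvg_cst); (apply: cvgM; first exact: cvg_cst);
    exact: cpow.
- by rewrite /q !sgn !sgn1 s1 s2 /a'; field.
- rewrite /q' !sgn !sgn1 s0 s1 /b' /c; field.
  by rewrite !gt_eqF.
have cq : continuous q.
  by move=> x; apply: cvgD; (apply: cvgM; first exact: cvg_cst); exact: cpow.
have cabs : continuous (fun x => `|q x|) by move=> x; exact: (cvg_norm (cq x)).
have cC : continuous (fun x => C * (c * x) ^+ p.+1).
  by move=> x; apply: cvgM; [exact: cvg_cst|exact: cpow].
have H x : - T <= x <= T -> `|q x| <= C * (c * x) ^+ p.+1.
  move=> /andP[Tx xT].
  have cx : `|c * x| <= 1.
    rewrite normrM gtr0_norm ?invr_gt0 // mulrC ler_pdivrMr // mul1r ler_norml.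
    by rewrite Tx.
  have pe : `|c * x| ^+ p.+1 = (c * x) ^+ p.+1.
    by rewrite -normrX ger0_norm // exprn_even_ge0 // /p /= odd_double.
  rewrite /q (le_trans (ler_normD _ _)) // (normrM a') (normrM b') !normrX.
  rewrite [_ ^+ p.+2]exprS pe.
  have pw0 : 0 <= (c * x) ^+ p.+1 by rewrite -pe exprn_ge0.
  have a'0 : `|a'| <= `|a|.
    by rewrite normrM normfV [`|2|]ger0_norm // ler_pdivrMr // ler_peMr // ler1n.
  have b'0 : `|b'| <= `|b| * T.
    rewrite /b' normrM normfV normrM (ger0_norm T0) [`|2 * _|]ger0_norm ?mulr_ge0 //.
    rewrite ler_pdivrMr ?mulr_gt0 // ler_peMr ?mulr_ge0 //.
    by rewrite -natrM ler1n.
  rewrite mulrDl; apply: lerD; last by rewrite ler_wpM2r.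
  rewrite mulrA ler_wpM2r //; apply: le_trans a'0.
  by rewrite ler_piMr.
apply: le_trans (le_int_itv cabs cC H) _.
pose F x := C * T / p.+2%:R * (c * x) ^+ p.+2.
have dF (x : R) : is_derive x 1 F (C * (c * x) ^+ p.+1).
  have := is_deriveZ (C * T / p.+2%:R) (power_is_derive c p.+1 x).
  set z := (X in is_derive _ _ _ X) => D; suff <- : z = C * (c * x) ^+ p.+1 by exact: D.
  rewrite /z /GRing.scale /= /c; field.
  by rewrite !gt_eqF.
rewrite (int_itvE NTT cC dF) /F sgn sgn1 s2.
rewrite (_ : _ - _ = C * (2 * T) / p.+2%:R); last by ring.
rewrite ler_pdivrMr; last by [].
apply/ltW/(lt_le_trans kP); rewrite ler_pM2l // ler_nat /p; lia.
Qed.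

(** A uniform approximation is corrected at the boundary, at a small cost in
    [L^1], and then by a small constant that restores the integral. *)
Lemma C1_L1_approx (v : R -> R) (a b e : R) : continuous v -> 0 < e ->
  exists w w' : R -> R, [/\ forall x : R, is_derive x 1 w (w' x), continuous w',
    w T - w (- T) = a, w' T - w' (- T) = b
    & int_itv (- T) T w = int_itv (- T) T v /\
      int_itv (- T) T (fun x => `|w x - v x|) <= e].
Proof.
move=> cv e0; pose h := e / (2 * (2 * T + 1)).
have h0 : 0 < h by rewrite divr_gt0 // mulr_gt0 // addr_gt0 // mulr_gt0.
have hE : 2 * (2 * T * h + h) = e.
  by rewrite /h; field; rewrite gt_eqF // addr_gt0 // mulr_gt0.
have [m [m' [dm cm' mv]]] := C1_uniform_approx cv h0.
have [q [q' [dq cq' qT q'T qh]]] :=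
  @boundary_corrector (a - (m T - m (- T))) (b - (m' T - m' (- T))) h h0.
have cm := is_derive_continuous dm; have cq := is_derive_continuous dq.
pose d x := m x - v x + q x.
have cmv : continuous (fun x => m x - v x).
  by move=> x; apply: cvgB; [exact: cm|exact: cv].
have cd : continuous d by move=> x; apply: cvgD; [exact: cmv|exact: cq].
have cN (f : R -> R) : continuous f -> continuous (fun x => `|f x|).
  by move=> cf x; exact: (cvg_norm (cf x)).
have cD (f g : R -> R) : continuous f -> continuous g -> continuous (fun x => f x + g x).
  by move=> cf cg x; apply: cvgD; [exact: cf|exact: cg].
pose I := int_itv (- T) T d.
have dh : int_itv (- T) T (fun x => `|d x|) <= 2 * T * h + h.
  apply: (@le_trans _ _ (int_itv (- T) T (fun x => `|m x - v x| + `|q x|))).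
    apply: le_int_itv => [||x _]; first exact: cN.
      by apply: cD; exact: cN.
    exact: ler_normD.
  rewrite int_itvD; [|exact: cN|exact: cN]; apply: lerD => //.
  apply: le_trans (le_int_itv (cN _ cmv) (@cst_continuous _ _ h) mv) _.
  rewrite int_itv_cst // opprK (_ : h * _ = 2 * T * h) //; ring.
have Ih : `|I| <= 2 * T * h + h.
  apply: le_trans dh; apply: le_normr_Rintegral => //; exact: integrable_itv.
pose k := - I / (2 * T).
have kT : k * (2 * T) = - I by rewrite /k; field; rewrite gt_eqF.
exists (fun x => v x + d x + k), (fun x => m' x + q' x); split.
- move=> x; rewrite (_ : (fun x => _) = fun x => m x + q x + k).
    have := is_deriveD (is_deriveD (dm x) (dq x)) (is_derive_cst k x (1 : R)).
    by rewrite addr0.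
  by apply/funext => y; rewrite /d; ring.
- exact: cD.
- by rewrite /d; move: qT; lra.
- by move: q'T; lra.
split.
  rewrite (@int_itvD _ _ _ (fun x => v x + d x) (fun=> k)); first last.
  - exact: cst_continuous.
  - exact: cD.
  rewrite int_itvD // int_itv_cst // opprK.
  by rewrite (_ : T + T = 2 * T) ?kT ?addrK //; ring.
apply: (@le_trans _ _ (int_itv (- T) T (fun x => `|d x| + `|k|))).
  apply: le_int_itv.
  - apply: cN => x; apply: cvgB; last exact: cv.
    by apply: cvgD; [exact: (cD _ _ cv cd)|exact: cvg_cst].
  - by apply: cD; [exact: cN|exact: cst_continuous].
  - move=> x _; rewrite (_ : _ - _ = d x + k); last by ring.
    exact: ler_normD.
rewrite int_itvD; [|exact: cN|exact: cst_continuous].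
rewrite int_itv_cst // opprK (_ : `|k| * (T + T) = `|I|).
  by move: dh Ih; rewrite -hE; lra.
have -> : T + T = `|2 * T| by rewrite gtr0_norm ?mulr_gt0 //; ring.
by rewrite -normrM kT normrN.
Qed.

End Approximation.

(** * Minimizers and minimum-input solutions *)

Section Minimization.
Context {R : realType}.
Variables (T : R) (f0 fT : R -> R) (K1 K2 : nat).
Hypothesis T_gt0 : 0 < T.
Hypothesis f0_smooth : smooth f0.
Hypothesis fT_smooth : smooth fT.

Let NTT : - T <= T. Proof. by rewrite ge0_cp ?ltW. Qed.
Let NTlt : - T < T. Proof. by move: T_gt0; lra. Qed.

Local Notation K := (nb_pieces K1 K2).
Local Notation sorted_at := (sorted_values T f0 fT K1 K2).
Local Notation A := (cA T f0 fT).

Lemma size_sorted_values x : size (sorted_at x) = K.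
Proof. by rewrite /sorted_values size_sort size_map size_iota. Qed.

Lemma sorted_values_sorted x : sorted >=%R (sorted_at x).
Proof. exact/sort_sorted/ge_total. Qed.

Lemma dist_sum_sorted v x :
  dist_sum T f0 fT K1 K2 v x = \sum_(a <- sorted_at x) `|v x - a|.
Proof.
rewrite /dist_sum -(big_map (fun i => t_fun T f0 fT K2 i x) xpredT (fun a => `|v x - a|)).
by apply: perm_big; rewrite perm_sym perm_sort.
Qed.

Lemma between_excess j x (y : R) : (j <= K)%N ->
  (a_ T f0 fT K1 K2 j.+1 x <= y%:E <= a_ T f0 fT K1 K2 j x)%E =
  (excess (sorted_at x) j y == 0).
Proof.
move=> jK; rewrite -excess_eq0_nth ?size_sorted_values //.
exact: sorted_values_sorted.
Qed.

(** The slope of the sum of distances between the [j]-th and the next sorted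
    value. *)
Definition slope j : R := (K - j)%:R - j%:R.

Lemma dist_sum_excess j (v w : R -> R) x : (j <= K)%N ->
  dist_sum T f0 fT K1 K2 w x - dist_sum T f0 fT K1 K2 v x - slope j * (w x - v x) =
  excess (sorted_at x) j (w x) - excess (sorted_at x) j (v x).
Proof.
move=> jK; rewrite !dist_sum_sorted -sum_dist_excess size_drop size_takel.
  by rewrite size_sorted_values.
by rewrite size_sorted_values.
Qed.

Lemma int_itv_clamp v : int_itv (- T) T (clamp (- T) T v) = int_itv (- T) T v.
Proof. by apply: eq_int_itv => x xT; rewrite clampE. Qed.

(** For [v] in [S_ j], replacing [v x] by [w x] changes the sum of distances by
    [slope j * (w x - v x)] plus the nonnegative excess of [w x]. The first term
    integrates to zero, since both integrals are [A]; the second one vanishes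
    identically only if [w] is in [S_ j]. *)
Lemma S_compare j v w : (j <= K)%N -> S_ T f0 fT K1 K2 j v ->
  C_integral_A T f0 fT w ->
  (J1 T f0 fT K1 K2 v <= J1 T f0 fT K1 K2 w)%E /\
  (J1 T f0 fT K1 K2 w = J1 T f0 fT K1 K2 v -> S_ T f0 fT K1 K2 j w).
Proof.
move=> jK [cv vS vA] [cw wA].
have ccv := clamp_continuous NTT cv; have ccw := clamp_continuous NTT cw.
rewrite !(J1E T_gt0 f0_smooth fT_smooth) //.
pose vc := clamp (- T) T v; pose wc := clamp (- T) T w.
pose G x := dist_sum T f0 fT K1 K2 wc x - dist_sum T f0 fT K1 K2 vc x
            - slope j * (wc x - vc x).
have cdv := @continuous_dist_sum _ _ _ _ f0_smooth fT_smooth K1 K2 vc ccv.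
have cdw := @continuous_dist_sum _ _ _ _ f0_smooth fT_smooth K1 K2 wc ccw.
have cB (f g : R -> R) : continuous f -> continuous g -> continuous (fun x => f x - g x).
  by move=> cf cg x; apply: cvgB; [exact: cf|exact: cg].
have cs : continuous (fun x => slope j * (wc x - vc x)).
  by move=> x; apply: cvgM; [exact: cvg_cst|exact: (cB _ _ ccw ccv)].
have cG : continuous G by apply: (cB _ _) => //; exact: (cB _ _).
have GE x : - T <= x <= T -> G x = excess (sorted_at x) j (w x).
  move=> xT; rewrite /G dist_sum_excess // /wc /vc !clampE //.
  have /eqP -> : excess (sorted_at x) j (v x) == 0.
    by rewrite -between_excess // vS // in_itv.
  by rewrite subr0.
have G0 x : - T <= x <= T -> 0 <= G x by move=> /GE ->; exact: excess_ge0.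
have IG : int_itv (- T) T G =
    int_itv (- T) T (dist_sum T f0 fT K1 K2 wc) -
    int_itv (- T) T (dist_sum T f0 fT K1 K2 vc).
  rewrite /G int_itvB //; last exact: cB.
  rewrite int_itvB // (int_itvZ _ _ _ (cB _ _ ccw ccv)) int_itvB //.
  by rewrite !int_itv_clamp vA wA subrr mulr0 subr0.
split; first by rewrite lee_fin -subr_ge0 -IG; exact: int_itv_ge0.
move=> [e]; split=> // x; rewrite in_itv /= => xT.
rewrite between_excess // -GE // (int_itv_eq0 NTlt cG G0) //.
by rewrite IG e subrr.
Qed.

Lemma S_C_integral j v : S_ T f0 fT K1 K2 j v -> C_integral_A T f0 fT v.
Proof. by move=> [cv _ vA]. Qed.

Lemma S_minimizer j v : (j <= K)%N -> S_ T f0 fT K1 K2 j v ->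
  J1_minimizer T f0 fT K1 K2 v.
Proof.
move=> jK Sv; split; first exact: S_C_integral Sv.
by move=> w Cw; have [] := S_compare jK Sv Cw.
Qed.

Definition level i x : R := nth 0 (sorted_at x) i.

Lemma level_continuous i : (i < K)%N -> continuous (level i).
Proof.
move=> iK; apply: sort_nth_continuous; last by rewrite size_iota.
by move=> k; exact: continuous_t_fun.
Qed.

Lemma level_mono i x : (i.+1 < K)%N -> level i.+1 x <= level i x.
Proof.
move=> iK; apply: (sorted_leq_nth ge_trans ge_refl 0 (sorted_values_sorted x)) => //.
  by rewrite inE size_sorted_values ltnW.
by rewrite inE size_sorted_values.
Qed.

Lemma a_levelE i x : (i < K)%N -> a_ T f0 fT K1 K2 i.+1 x = (level i x)%:E.
Proof. by move=> iK; rewrite /a_ /= (nth_map 0) // size_sorted_values. Qed.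

Lemma a_lastE x : a_ T f0 fT K1 K2 K.+1 x = -oo%E.
Proof. by rewrite /a_ /= nth_default // size_map size_sorted_values. Qed.

Lemma C_integral_shift (g : R -> R) : continuous g ->
  C_integral_A T f0 fT (fun x => g x + (A - int_itv (- T) T g) / (2 * T)).
Proof.
move=> cg; split.
  by apply: C0_itv_continuous => x; apply: cvgD; [exact: cg|exact: cvg_cst].
rewrite int_itvD //; last exact: cst_continuous.
rewrite int_itv_cst // opprK; field.
by rewrite gt_eqF.
Qed.

(** The integrals of the sorted values decrease, so [A] lies between two
    consecutive ones, or beyond the extreme ones; interpolate or translate. *)
Lemma S_nonempty : exists j, (j <= K)%N /\ S_ T f0 fT K1 K2 j !=set0.
Proof.
pose B i := int_itv (- T) T (level i).
have K0 : (0 < K)%N by rewrite /nb_pieces addn1.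
have K1K : K.-1.+1 = K by rewrite prednK.
have KK : (K.-1 < K)%N by rewrite prednK.
have T2 : 0 < 2 * T by rewrite mulr_gt0.
have [AB0|AB0] := leP (B 0%N) A.
  have [c i] := C_integral_shift (level_continuous K0).
  exists 0%N; split=> //; eexists; split; [exact: c| |exact: i].
  move=> x _; rewrite a_levelE // lee_fin leey andbT lerDl.
  by rewrite divr_ge0 ?(ltW T2) // subr_ge0.
have [ABK|ABK] := leP A (B K.-1).
  have [c i] := C_integral_shift (level_continuous KK).
  exists K; split=> //; eexists; split; [exact: c| |exact: i].
  move=> x _; have := a_levelE x KK; rewrite K1K a_lastE leNye /= => ->.
  rewrite lee_fin gerDl.
  by rewrite pmulr_lle0 ?invr_gt0 // subr_le0.
have [i [iK Bi]] : exists i, (i.+1 < K)%N /\ B i.+1 <= A <= B i.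
  have : (K.-1 < K)%N by [].
  elim: K.-1 ABK => [|n IH] ABn nK; first by move: (lt_trans AB0 ABn); rewrite ltxx.
  have [ABn'|ABn'] := leP A (B n); first by exists n; rewrite nK (ltW ABn) ABn'.
  by apply: IH => //; exact: ltnW.
have ci := level_continuous (ltnW iK); have ci1 := level_continuous iK.
have [th th01 thE] : exists2 th : R, 0 <= th <= 1 & th * (B i - B i.+1) = A - B i.+1.
  have [e|ne] := eqVneq (B i) (B i.+1).
    exists 0; first by rewrite lexx ler01.
    by move: Bi; rewrite e mul0r -eq_le => /eqP ->; rewrite subrr.
  have d0 : 0 < B i - B i.+1.
    rewrite subr_gt0 lt_neqAle eq_sym ne /=.
    by move: Bi => /andP[]; exact: le_trans.
  exists ((A - B i.+1) / (B i - B i.+1)); last by rewrite divfK // gt_eqF.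
  have /andP[B1 B2] := Bi; apply/andP; split.
    by apply: divr_ge0; [rewrite subr_ge0|exact: ltW].
  by rewrite ler_pdivrMr // mul1r lerD2r.
have cd : continuous (fun x => level i x - level i.+1 x).
  by move=> x; apply: cvgB; [exact: ci|exact: ci1].
have cth : continuous (fun x => th * (level i x - level i.+1 x)).
  by move=> x; apply: cvgM; [exact: cvg_cst|exact: cd].
exists i.+1; split; first exact: ltnW.
exists (fun x => level i.+1 x + th * (level i x - level i.+1 x)); split.
- by apply: C0_itv_continuous => x; apply: cvgD; [exact: ci1|exact: cth].
- move=> x _; rewrite a_levelE // a_levelE ?(ltnW iK) // !lee_fin.
  by have := level_mono x iK; case/andP: th01 => *; nra.
- rewrite int_itvD // (int_itvZ _ _ _ cd) int_itvB //.
  by rewrite -/(B i) -/(B i.+1) thE addrC subrK.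
Qed.

(** A minimizer has the same value as some element of some [S_ j], so the
    equality case of the comparison applies. *)
Lemma minimizer_S v : C_integral_A T f0 fT v -> J1_minimizer T f0 fT K1 K2 v ->
  exists j, (j <= K)%N /\ S_ T f0 fT K1 K2 j v.
Proof.
move=> Cv [_ minv]; have [j [jK [s Ss]]] := S_nonempty; exists j; split=> //.
have [le eqS] := S_compare jK Ss Cv; apply: eqS.
by apply/eqP; rewrite eq_le le minv //; exact: S_C_integral Ss.
Qed.

Lemma C1_compatible_of_derivative (w w' : R -> R) :
  (forall x : R, is_derive x 1 w (w' x)) -> continuous w' ->
  w T = w (- T) + c1 T f0 fT -> w' T = w' (- T) + c2 T f0 fT ->
  C1_compatible T f0 fT w.
Proof.
move=> dw cw' wT w'T.
have dE x : - T <= x <= T -> derivable_within `[- T, T] w x /\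
    derive_within `[- T, T] w x = w' x.
  by move=> xT; exact: is_derive_within NTlt xT (dw x).
split=> //.
  split; first by move=> x; rewrite in_itv /= => xT; case: (dE x xT).
  apply: (@eq_C0_itv _ _ _ w'); last exact: C0_itv_continuous.
  by move=> x /dE[].
by rewrite (dE T _).2 ?(dE (- T) _).2 ?lexx ?NTT.
Qed.

(** The boundary conditions are the relation satisfied by the input at [x = 0] and
    its derivative. *)
Lemma input_compatible u : is_solution T f0 fT u ->
  C1_compatible T f0 fT (input T u).
Proof.
move=> su; have [dw cw'] := input_C1 T_gt0 su.
have hw := input_is_hat T_gt0 su.
apply: (C1_compatible_of_derivative dw cw').
  exact: (is_hat_endpoint T_gt0 hw).
set w' := dx _ 0 in dw cw' *.
have d1 := is_derive_shift_arg (dw (0 + T)).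
have d2 := is_derive_shift_arg (dw (0 + - T)).
have d3 := is_deriveZ 2 (smooth_is_derive fT_smooth 1 0).
have d4 := is_derive_shift_arg (smooth_is_derive f0_smooth 1 (0 + T)).
have d5 := is_derive_shift_arg (smooth_is_derive f0_smooth 1 (0 + - T)).
have := is_deriveB (is_deriveB (is_deriveD d2 d3) d4) d5.
have -> : (fun x => input T u (x + - T)) + (2 \*: fT^`(1))
    - (fun x => f0^`(1) (x + T)) - (fun x => f0^`(1) (x + - T)) =
    (fun x => input T u (x + T)).
  by apply/funext => x; rewrite (hw.2 x).
move=> d6; have := derive1_is_derive d6; rewrite (derive1_is_derive d1) !add0r => ->.
by rewrite /c2 /GRing.scale /= !addrA.
Qed.

Lemma input_C_integral u : is_solution T f0 fT u -> C_integral_A T f0 fT (input T u).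
Proof.
move=> su; have [dw _] := input_C1 T_gt0 su; split.
  exact/C0_itv_continuous/(is_derive_continuous dw).
exact: input_integral.
Qed.

Lemma J1_input u : is_solution T f0 fT u ->
  J1 T f0 fT K1 K2 (input T u) = input_norm T K1 K2 (input T u).
Proof.
move=> su; rewrite /J1; congr input_norm.
exact: (is_hat_unique T_gt0 (hatP f0 fT T_gt0 _) (input_is_hat T_gt0 su)).
Qed.

Lemma dist_sum_lipschitz v w x :
  dist_sum T f0 fT K1 K2 w x <= dist_sum T f0 fT K1 K2 v x + K%:R * `|w x - v x|.
Proof.
rewrite /dist_sum; set t := fun i => t_fun T f0 fT K2 i x.
have -> : K%:R * `|w x - v x| = \sum_(i <- indices K1 K2) `|w x - v x|.
  by rewrite big_const_seq count_predT iter_addr_0 size_iota mulr_natl.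
rewrite -big_split /=; apply: ler_sum => i _.
rewrite (_ : w x - _ = (v x - t i) + (w x - v x)); last by rewrite /t; ring.
exact: ler_normD.
Qed.

(** A minimizer need not be compatible, but compatible functions with integral
    [A] approximate it in [L^1], and their extensions are inputs. *)
Lemma minimum_eq_inf v : J1_minimizer T f0 fT K1 K2 v ->
  J1 T f0 fT K1 K2 v =
  ereal_inf [set input_norm T K1 K2 w | w in input_space T f0 fT].
Proof.
move=> [[cv vA] minv]; apply/eqP; rewrite eq_le; apply/andP; split.
  apply/ereal_infP => _ [_ [u su ->] <-].
  by rewrite -J1_input //; apply: minv; exact: input_C_integral.
apply/lee_addgt0Pr => e e0; rewrite (J1E T_gt0 f0_smooth fT_smooth) //.
have ccv := clamp_continuous NTT cv; pose vc := clamp (- T) T v.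
have K0 : 0 < K%:R :> R by rewrite ltr0n /nb_pieces addn1.
have [w [w' [dw cw' wT w'T [wI wv]]]] :=
  C1_L1_approx T_gt0 (c1 T f0 fT) (c2 T f0 fT) ccv (divr_gt0 e0 K0).
have cw := is_derive_continuous dw.
have Cw : C1_compatible T f0 fT w.
  by apply: (C1_compatible_of_derivative dw cw'); rewrite -?wT -?w'T addrC subrK.
have iw : int_itv (- T) T w = A by rewrite wI int_itv_clamp.
have c0w : C0_itv (- T) T w by exact: C0_itv_continuous.
have [su iu] := induced_is_solution T_gt0 f0_smooth fT_smooth c0w Cw iw.
apply: (@le_trans _ _ (J1 T f0 fT K1 K2 w)).
  apply: ereal_inf_lbound; exists (hat T f0 fT w) => //.
  by exists (induced_sol f0 (hat T f0 fT w)).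
rewrite (J1E T_gt0 f0_smooth fT_smooth) // -EFinD lee_fin.
have cdv := @continuous_dist_sum _ _ _ _ f0_smooth fT_smooth K1 K2 vc ccv.
have cdw := @continuous_dist_sum _ _ _ _ f0_smooth fT_smooth K1 K2 w cw.
have -> : int_itv (- T) T (dist_sum T f0 fT K1 K2 (clamp (- T) T w)) =
    int_itv (- T) T (dist_sum T f0 fT K1 K2 w).
  by apply: eq_int_itv => x xT; rewrite /dist_sum clampE.
have cn : continuous (fun x => `|w x - vc x|).
  exact: continuous_norm_sub.
have cKn : continuous (fun x => K%:R * `|w x - vc x|).
  by move=> x; apply: cvgM; [exact: cvg_cst|exact: cn].
apply: (@le_trans _ _ (int_itv (- T) T
    (fun x => dist_sum T f0 fT K1 K2 vc x + K%:R * `|w x - vc x|))).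
  apply: le_int_itv => //.
    by move=> x; apply: cvgD; [exact: cdv|exact: cKn].
  by move=> x _; exact: dist_sum_lipschitz.
rewrite int_itvD // (int_itvZ _ _ _ cn) lerD2l.
by rewrite mulrC -ler_pdivlMr.
Qed.

Lemma compatible_is_MS j v : (j <= K)%N -> S_ T f0 fT K1 K2 j v ->
  C1_compatible T f0 fT v ->
  is_MS T f0 fT K1 K2 (induced_sol f0 (hat T f0 fT v)).
Proof.
move=> jK Sv Cv; have [cv _ vA] := Sv.
have [su iu] := induced_is_solution T_gt0 f0_smooth fT_smooth cv Cv vA.
split=> // w ws; rewrite iu -/(J1 T f0 fT K1 K2 v) (minimum_eq_inf (S_minimizer jK Sv)).
by apply: ereal_inf_lbound; exists w.
Qed.

Lemma MS_input_minimizer u : is_MS T f0 fT K1 K2 u ->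
  J1_minimizer T f0 fT K1 K2 (input T u).
Proof.
move=> [su minu]; split; first exact: input_C_integral.
move=> w Cw; have [j [jK [s Ss]]] := S_nonempty.
have mins := S_minimizer jK Ss.
apply: (@le_trans _ _ (J1 T f0 fT K1 K2 s)); last by case: mins => _; apply.
rewrite (minimum_eq_inf mins) J1_input //.
by apply/ereal_infP => _ [z zs <-]; exact: minu.
Qed.

End Minimization.

Theorem mainTheorem4 (R : realType) (T : R) (f0 fT : R -> R) (K1 K2 : nat)
    (T_gt0 : 0 < T) (f0_smooth : smooth f0) (fT_smooth : smooth fT)
    (K1_ge1 : (1 <= K1)%N) (K2_ge1 : (1 <= K2)%N) :
  (* (i) *)
  [/\ exists j : nat,
        (j <= nb_pieces K1 K2)%N /\ S_ T f0 fT K1 K2 j !=set0,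
      forall v : R -> R, C_integral_A T f0 fT v ->
        (J1_minimizer T f0 fT K1 K2 v <->
         exists j : nat, (j <= nb_pieces K1 K2)%N /\ S_ T f0 fT K1 K2 j v)
    & forall v : R -> R, J1_minimizer T f0 fT K1 K2 v ->
        J1 T f0 fT K1 K2 v =
        ereal_inf [set input_norm T K1 K2 w | w in input_space T f0 fT]]
  /\
  (* (ii) *)
  ((exists u : R -> R -> R, is_MS T f0 fT K1 K2 u) <->
   (exists (j : nat) (v : R -> R),
      [/\ (j <= nb_pieces K1 K2)%N, S_ T f0 fT K1 K2 j v
        & C1_compatible T f0 fT v]))
  /\
  (forall (j : nat) (v : R -> R),
     (j <= nb_pieces K1 K2)%N -> S_ T f0 fT K1 K2 j v ->
     C1_compatible T f0 fT v ->
     is_MS T f0 fT K1 K2 (induced_sol f0 (hat T f0 fT v))).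
Proof.
have MS j v : (j <= nb_pieces K1 K2)%N -> S_ T f0 fT K1 K2 j v ->
    C1_compatible T f0 fT v ->
    is_MS T f0 fT K1 K2 (induced_sol f0 (hat T f0 fT v)).
  exact: compatible_is_MS.
split; first split.
- exact: S_nonempty.
- move=> v Cv; split; first exact: minimizer_S.
  by move=> [j [jK Sv]]; exact: S_minimizer Sv.
- exact: minimum_eq_inf.
split=> //; split=> [[u msu]|[j [v [jK Sv Cv]]]]; last by eexists; exact: MS Sv Cv.
have mu := MS_input_minimizer T_gt0 f0_smooth fT_smooth msu.
have [j [jK Su]] := minimizer_S T_gt0 f0_smooth fT_smooth mu.1 mu.
exists j, (input T u); split=> //.
by apply: input_compatible => //; case: msu.
Qed.
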